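(* Assume that $\mathrm{cone}(\mathcal{B})$ is closed, that $K^*=\mathscr{P}_d(S)+\mathcal{B}^*$, and that $S=\{\xi\in\mathbb{R}^p:g_1(\xi)\ge0,\ldots,g_{m_1}(\xi)\ge0\}$ is compact, for a polynomial tuple $g=(g_1,\ldots,g_{m_1})$. Suppose the Algorithm described in the context terminates in finitely many loops with optimizers $(t^*,x^*,w^* )$ and $(\gamma_0^*,\gamma^*,y_1^*,\ldots,y_m^* )$. If $t^*=\gamma_0^*-\sum_{j=1}^mc_j^\top y_j^*$, then $(t^*,x^* )$ is an optimizer of the distributionally robust problem $$\min_{(t,x)}\ t\quad\text{s.t.}\quad t\in\mathbb{R},\ x\in X,\quad \sum_{j=1}^m\mathbb{E}_{\mu_j}[f_j(t,x,\lambda,\xi)]\ge0\ \ \text{for all }\mu_1,\ldots,\mu_m\in\mathcal{M}(S)\text{ with }\sum_{j=1}^m\mu_j\in\mathcal{M},$$ which is the equivalent reformulation of the original problem $\min\{t: \sup_{\mu\in\mathcal{M}}\mathbb{E}_\mu[l(-x^\top r(\xi)-t)]\le\lambda,\ x\in X,\ t\in\mathbb{R}\}$.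
   Context: Notation. $[m]=\{1,\ldots,m\}$; $\mathbb{N}_d^p=\{\alpha\in\mathbb{N}^p:|\alpha|\le d\}$; $[\xi]_d$ is the vector of all monomials $\xi^\alpha$, $\alpha\in\mathbb{N}_d^p$, in $\xi=(\xi_1,\ldots,\xi_p)$; $e=(1,\ldots,1)^\top\in\mathbb{R}^n$; $e_1=(1,0,\ldots,0)^\top\in\mathbb{R}^{\mathbb{N}_d^p}$ (entry $1$ at $\alpha=0$). $\mathrm{cone}(\cdot)$ is the conic hull. Vectors $y\in\mathbb{R}^{\mathbb{N}_d^p}$ are called truncated multi-sequences (tms) of degree $d$. Polynomials $q=\sum q_\alpha\xi^\alpha$ and tms are paired by $\langle q,y\rangle=\sum_\alpha q_\alpha y_\alpha$ (when $\deg q$ is at most the degree of $y$); for a set $C$ of tms of degree $d$, $C^*=\{q\in\mathbb{R}[\xi]_d:\langle q,y\rangle\ge0\ \forall y\in C\}$. $\deg(g)$ is the highest degree of the $g_i$. $\mathcal{M}(S)$ is the set of finite nonnegative measures supported on $S$, $\mathcal{P}(S)$ the probability measures supported on $S$; $\mathbb{E}_\mu$ denotes integration against $\mu$. Data. $r=(r_1,\ldots,r_n)^\top$ is a vector of polynomials in $\xi$ with $\deg(r)=d$; $\lambda>0$; $l(Z)=\max_{j\in[m]}\{a_jZ+b_j\}$ with real $a_j,b_j$ is increasing and non-constant; $X=\{x\in\mathbb{R}^n:x\ge0,\ e^\top x=1\}$; $f_j(t,x,\lambda,\xi)=\lambda-(a_j(-x^\top r(\xi)-t)+b_j)=(a_je_1t+A_jx+c_j)^\top[\xi]_d$,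 which uniquely defines $A_j\in\mathbb{R}^{\binom{p+d}{d}\times n}$ and $c_j\in\mathbb{R}^{\binom{p+d}{d}}$. $\mathcal{B}\subseteq\mathbb{R}^{\mathbb{N}_d^p}$ is a (convex) set given by linear, second-order or semidefinite constraints and $\mathcal{M}=\{\mu\in\mathcal{P}(S):\mathbb{E}_\mu([\xi]_d)\in\mathcal{B}\}$. Cones. $\mathscr{P}_d(S)$: real polynomials of degree at most $d$ nonnegative on $S$. $\mathscr{R}_d(S)=\mathrm{cone}(\{[\xi]_d:\xi\in S\})$. $K=\mathrm{cone}(\{\mathbb{E}_\mu[[\xi]_d]:\mu\in\mathcal{M}\})=\mathscr{R}_d(S)\cap\mathrm{cone}(\mathcal{B})$ ($\mathcal B$ is understood to be such that these two descriptions agree). $\Sigma[\xi]_s$: sums of squares of polynomials, of degree at most $s$. $\mathrm{QM}[g]_k=\Sigma[\xi]_{2k}+\sum_ig_i\cdot\Sigma[\xi]_{2k-\deg(g_i)}$. For a tms $z$ of degree $2k$, let $\mathscr{L}_z$ be the linear functional with $\mathscr{L}_z(\xi^\alpha)=z_\alpha$; the localizing matrix $L_q^{(k)}[z]$ is the symmetric matrix with $\mathrm{vec}(a)^\top L_q^{(k)}[z]\mathrm{vec}(b)=\mathscr{L}_z(qab)$ for all polynomials $a,b$ of degree at most $k-\lceil\deg(q)/2\rceil$ ($\mathrm{vec}$ is the coefficient vector); the moment matrix is $M_k[z]=L_1^{(k)}[z]$ (also defined for tms of degree larger than $2k$, by truncation). $\mathscr{S}[g]_k=\{z\in\mathbb{R}^{\mathbb{N}_{2k}^p}:M_k[z]\succeq0,\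 L_{g_i}^{(k)}[z]\succeq0\ \forall i\}$. $z|_d=(z_\alpha)_{|\alpha|\le d}$. Relaxations of order $k\ge\max\{\lceil d/2\rceil,\lceil\deg(g)/2\rceil\}$: $$\text{(P}_k)\quad\min_{(t,x,w)}\ t\quad\text{s.t. }\ t\in\mathbb{R},\ x\in X,\ w^\top[\xi]_d\in\mathrm{QM}[g]_k+\mathcal{B}^*,\ (a_je_1t+A_jx+c_j-w)^\top[\xi]_d\in\mathrm{QM}[g]_k\ \forall j\in[m];$$ $$\text{(D}_k)\quad\max\ \gamma_0-\sum_{j=1}^mc_j^\top y_j\quad\text{s.t. }\begin{cases}\gamma_0\in\mathbb{R},\ \gamma\in\mathbb{R}^n,\ \gamma\ge0,\\ \sum_{j=1}^ma_j(e_1^\top y_j)=1,\ \gamma_0e+\gamma+\sum_{j=1}^mA_j^\top y_j=0,\\ y_j=z_j|_d,\ z_j\in\mathscr{S}[g]_k\ (j\in[m]),\\ \sum_{j=1}^my_j\in\mathrm{cone}(\mathcal{B}),\ \sum_{j=1}^mz_j\in\mathscr{S}[g]_k,\end{cases}$$ with variables $(\gamma_0,\gamma,y_1,\ldots,y_m,z_1,\ldots,z_m)$ in (D$_k$). Algorithm. Let $t_0=\lceil d/2\rceil$, $t_c=\lceil\deg(g)/2\rceil$, $k:=\max\{t_0,t_c\}$, $l_j:=k+1$ for all $j\in[m]$, and choose a generic $R\in\Sigma[\xi]_{2t_0+2}$. Step 1: Solve (P$_k$) and (D$_k$), obtaining optimizers $(t^{(k)},x^{(k)},w^{(k)})$ and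 $(\gamma_0^{(k)},\gamma^{(k)},y_1^{(k)},\ldots,y_m^{(k)},z_1^{(k)},\ldots,z_m^{(k)})$ respectively. Step 2: For each $j\in[m]$ with $y_j^{(k)}\ne0$, solve $\min_{v_j}\langle R,v_j\rangle$ s.t. $v_j|_d=y_j^{(k)}$, $v_j\in\mathscr{S}[g]_{l_j}$. If this is infeasible for some $j$, set $k:=k+1$ and go to Step 1. Otherwise compute a minimizer $v_j^{(k)}$ and go to Step 3. Step 3: For each computed $v_j^{(k)}$, check whether there is an integer $s_j\in[\max\{t_0,t_c\},l_j]$ with $\operatorname{rank}M_{s_j-t_c}[v_j^{(k)}]=\operatorname{rank}M_{s_j}[v_j^{(k)}]$. If for some $j$ no such $s_j$ exists, set $l_j:=l_j+1$ and return to Step 2 for that $j$. Step 4: Let $y^*=\sum_jy_j^{(k)}$, find the finitely atomic measure $\mu^*$ on $S$ admitted by $y^*/y^*_0$ (where $y^*_0$ is the entry of $y^*$ at $\alpha=0$), and return $(t^*,x^*,w^* ):=(t^{(k)},x^{(k)},w^{(k)})$, $\gamma_0^*:=\gamma_0^{(k)}$, $\gamma^*:=\gamma^{(k)}$, $y_j^*:=y_j^{(k)}$ for $j\in[m]$, and terminate. *)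

(* Defs.v *)
From Stdlib Require Import Relation_Operators.
From HB Require Import structures.
From mathcomp Require Import all_boot all_order all_algebra.
From mathcomp Require Import all_classical all_reals all_analysis.
(* The notations of mpoly clash with those of MathComp-Analysis. *)
From mathcomp Require mpoly.
Import -(notations) mpoly.

Set Implicit Arguments.
Unset Strict Implicit.
Unset Printing Implicit Defensive.

Import Order.TTheory GRing.Theory Num.Theory.
Import numFieldNormedType.Exports.

Local Open Scope classical_set_scope.
Local Open Scope ring_scope.

Section LinearAlgebra.
Variable R : realType.

Definition dot (N : nat) (u v : 'cV[R]_N) : R := \sum_(i < N) u i 0 * v i 0.

Definition psdmx (N : nat) (A : 'M[R]_N) : Prop :=
  A^T = A /\ forall u : 'cV[R]_N, 0 <= dot u (A *m u).

(* The conic hull; it always contains 0. *)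
Definition cone (N : nat) (C : set 'cV[R]_N) : set 'cV[R]_N :=
  [set y | exists (s : nat) (c : 'I_s -> R) (u : 'I_s -> 'cV[R]_N),
     (forall i, 0 <= c i /\ C (u i)) /\ y = \sum_(i < s) c i *: u i].

Inductive conic_constraint (N : nat) : Type :=
  | Linear (a : 'cV[R]_N) (b : R)
  | SecondOrder (q : nat) (F : 'M[R]_(q, N)) (h : 'cV[R]_q)
      (a : 'cV[R]_N) (b : R)
  | Semidefinite (q : nat) (F0 : 'M[R]_q) (F : 'I_N -> 'M[R]_q).

Definition satisfies (N : nat) (c : conic_constraint N) (y : 'cV[R]_N) : Prop :=
  match c with
  | Linear a b => 0 <= dot a y + b
  | SecondOrder q F h a b =>
      Num.sqrt (dot (F *m y + h) (F *m y + h)) <= dot a y + b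
  | Semidefinite q F0 F => psdmx (F0 + \sum_(i < N) y i 0 *: F i)
  end.

Definition given_by_conic_constraints (N : nat) (C : set 'cV[R]_N) : Prop :=
  exists (s : nat) (c : 'I_s -> conic_constraint N),
    C = [set y | forall i, satisfies (c i) y].

Definition simplex (n : nat) : set 'cV[R]_n :=
  [set x | (forall i, 0 <= x i 0) /\ \sum_(i < n) x i 0 = 1].

End LinearAlgebra.

Section Moments.
Variables (R : realType) (p : nat).
Local Notation poly := (mpoly p R).

(* The exponents of degree at most d are indexed by their rank in the
   enumeration of the finite type of such exponents. *)
Definition nexp (d : nat) : nat := #|{: bmultinom p d.+1}|.

Definition expo (d : nat) (i : 'I_(nexp d)) : multinom p := bmnm (enum_val i).

Definition tms (d : nat) : Type := 'cV[R]_(nexp d).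

(* The entry of y at alpha, which is 0 when the degree of alpha exceeds d. *)
Definition entry (d : nat) (y : tms d) (alpha : multinom p) : R :=
  \sum_(i < nexp d | expo i == alpha) y i 0.

Definition trunc (d e : nat) (z : tms e) : tms d := \col_i entry z (expo i).

Definition e1 (d : nat) : tms d := \col_i (expo i == mnm0)%:R.

Definition mono_vec (d : nat) (xi : 'rV[R]_p) : tms d :=
  \col_i meval (xi 0) (mpolyX R (expo i)).

(* The polynomial w^T [xi]_d. *)
Definition poly_of (d : nat) (w : tms d) : poly :=
  \sum_(i < nexp d) w i 0 *: mpolyX R (expo i).

(* The coefficient vector of a polynomial of degree at most d. *)
Definition vec (d : nat) (q : poly) : 'cV[R]_(nexp d) := \col_i mcoeff (expo i) q.

(* The degree, with the convention that 0 has degree 0. *)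
Definition deg (q : poly) : nat := (msize q).-1.

Definition deg_tuple (s : nat) (q : 'I_s -> poly) : nat := \max_(i < s) deg (q i).

(* <q, y>, which is also the Riesz functional of y at q. *)
Definition pairing (d : nat) (q : poly) (y : tms d) : R :=
  \sum_(i < nexp d) mcoeff (expo i) q * y i 0.

(* [uphalf n] is the ceiling of n / 2. *)
Definition localizing_mx (q : poly) (k e : nat) (z : tms e) :
    'M[R]_(nexp (k - uphalf (deg q))) :=
  \matrix_(i, j) pairing (q * mpolyX R (expo i) * mpolyX R (expo j)) z.

Definition moment_mx (k e : nat) (z : tms e) := localizing_mx 1 k z.

Definition polys_upto (d : nat) : set poly := [set q | (deg q <= d)%N].

Lemma poly_of_vec (d : nat) (q : poly) : polys_upto d q -> poly_of (vec d q) = q.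
Proof.
move=> hq; apply/mpolyP => alpha; rewrite /poly_of raddf_sum /=.
under eq_bigr => i _ do rewrite mxE mcoeffZ mcoeffX.
have [lt_d|ge_d] := ltnP (mdeg alpha) d.+1.
  pose i0 : 'I_(nexp d) := enum_rank (BMultinom lt_d).
  have i0E : expo i0 = alpha by rewrite /expo enum_rankK.
  rewrite (bigD1 i0) //= i0E eqxx mulr1 big1 ?addr0 // => i ne_i.
  case: eqP => [eq_i|_]; last by rewrite mulr0.
  case/eqP: ne_i; apply/enum_val_inj/val_inj.
  by rewrite -[LHS]/(expo i) -[RHS]/(expo i0) eq_i i0E.
have expo_lt i : (mdeg (@expo d i) < d.+1)%N by rewrite /expo; case: (enum_val i).
rewrite big1 => [|i _]; last first.
  case: eqP => [eq_i|_]; last by rewrite mulr0.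
  by move: (expo_lt i); rewrite eq_i ltnNge ge_d.
symmetry; apply: memN_msupp_eq0; apply: contraL ge_d => /msize_mdeg_lt lt_q.
rewrite -ltnNge; apply: (leq_trans lt_q).
by move: hq; rewrite /polys_upto /= /deg; case: (msize q).
Qed.

Lemma pairing_sum (e : nat) (I : Type) (s : seq I) (F : I -> poly) (z : tms e) :
  pairing (\sum_(i <- s) F i) z = \sum_(i <- s) pairing (F i) z.
Proof.
rewrite /pairing exchange_big /=; apply: eq_bigr => j _.
by rewrite raddf_sum mulr_suml.
Qed.

Lemma pairingZ (e : nat) (x : R) (q : poly) (z : tms e) :
  pairing (x *: q) z = x * pairing q z.
Proof.
by rewrite /pairing mulr_sumr; apply: eq_bigr => i _; rewrite mcoeffZ mulrA.
Qed.

(* The property that characterizes the localizing matrix. *)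
Lemma localizing_mxP (q : poly) (k e : nat) (z : tms e) (f h : poly) :
  let s := (k - uphalf (deg q))%N in
  polys_upto s f -> polys_upto s h ->
  dot (vec s f) (localizing_mx q k z *m vec s h) = pairing (q * f * h) z.
Proof.
move=> s hf hh; rewrite -[in RHS](poly_of_vec hf) -[in RHS](poly_of_vec hh).
rewrite /poly_of [q * _]mulr_sumr mulr_suml pairing_sum /dot.
apply: eq_bigr => i _; rewrite mulr_sumr pairing_sum !mxE mulr_sumr.
apply: eq_bigr => j _.
rewrite -!scalerAr -scalerAl !pairingZ !mxE -[LHS]/(_ * (_ * _)).
by rewrite [LHS]mulrC -[LHS]mulrA [LHS]mulrCA.
Qed.

Definition dual_cone (d : nat) (C : set (tms d)) : set poly :=
  [set q | polys_upto d q /\ forall y, C y -> 0 <= pairing q y].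

Definition nonneg_polys (d : nat) (S : set 'rV[R]_p) : set poly :=
  [set q | polys_upto d q /\ forall xi, S xi -> 0 <= meval (xi 0) q].

Definition moment_cone (d : nat) (S : set 'rV[R]_p) : set (tms d) :=
  cone [set mono_vec d xi | xi in S].

Definition add_sets (A B : set poly) : set poly :=
  [set q1 + q2 | q1 in A & q2 in B].

Definition sos (s : nat) : set poly :=
  [set q | polys_upto s q /\ exists us : seq poly, q = \sum_(u <- us) u ^+ 2].

Section SemialgebraicSet.
Variables (m1 : nat) (g : 'I_m1 -> poly).

Definition semialg_set : set 'rV[R]_p :=
  [set xi | forall i, 0 <= meval (xi 0) (g i)].

Definition qmodule (k : nat) : set poly :=
  [set q | exists (s0 : poly) (s : 'I_m1 -> poly),
     [/\ sos (2 * k) s0, forall i, sos (2 * k - deg (g i)) (s i)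
       & q = s0 + \sum_(i < m1) g i * s i]].

Definition moment_relax (k : nat) : set (tms (2 * k)) :=
  [set z | psdmx (moment_mx k z) /\ forall i, psdmx (localizing_mx (g i) k z)].

End SemialgebraicSet.

(* R^p with its Borel sigma-algebra. *)
Definition Rp := g_sigma_algebraType (@open 'rV[R]_p).

Definition supported (S : set 'rV[R]_p) (mu : {measure set Rp -> \bar R}) : Prop :=
  mu (~` S) = 0%E.

Definition moments (d : nat) (mu : {measure set Rp -> \bar R}) : tms d :=
  \col_i Rintegral mu setT (fun xi : Rp => mono_vec d xi i 0).

Definition ambiguity (d : nat) (S : set 'rV[R]_p) (B : set (tms d)) :
    set (probability Rp R) :=
  [set mu | supported S mu /\ B (moments d mu)].

Definition ambiguity_cone (d : nat) (S : set 'rV[R]_p) (B : set (tms d)) :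
    set (tms d) :=
  cone [set y | exists2 mu : probability Rp R, ambiguity S B mu & y = moments d mu].

Definition finitely_atomic (mu : {measure set Rp -> \bar R}) : Prop :=
  exists (s : nat) (c : 'I_s -> R) (u : 'I_s -> Rp),
    (forall i, 0 <= c i) /\
    forall A, measurable A -> mu A = (\sum_(i < s) (c i)%:E * \d_(u i) A)%E.

End Moments.

Arguments e1 {R p} d.
Arguments trunc {R p} d {e} z.
Arguments moments {R p} d mu.
Arguments sos {R p} s.
Arguments moment_cone {R p} d S.
Arguments moment_relax {R p m1} g k z.

Section Problems.
Variables (R : realType) (n p m : nat).

(* The maximum runs over the m.+1 >= 1 affine pieces; the initial value of the
   iteration is the piece 0. *)
Definition loss (a b : 'I_m.+1 -> R) (Z : R) : R :=
  \big[Num.max/a ord0 * Z + b ord0]_(j < m.+1) (a j * Z + b j).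

Definition returns (r : 'I_n -> mpoly p R) (x : 'cV[R]_n) (xi : 'rV[R]_p) : R :=
  \sum_(i < n) x i 0 * meval (xi 0) (r i).

Definition fpiece (lambda : R) (a b : 'I_m.+1 -> R) (r : 'I_n -> mpoly p R)
    (j : 'I_m.+1) (t : R) (x : 'cV[R]_n) (xi : 'rV[R]_p) : R :=
  lambda - (a j * (- returns r x xi - t) + b j).

Definition is_minimizer (feasible : R -> 'cV[R]_n -> Prop) (t : R)
    (x : 'cV[R]_n) : Prop :=
  feasible t x /\ forall t' x', feasible t' x' -> t <= t'.

Definition original_feasible (lambda : R) (a b : 'I_m.+1 -> R)
    (r : 'I_n -> mpoly p R) (d : nat) (S : set 'rV[R]_p) (B : set (tms R p d))
    (t : R) (x : 'cV[R]_n) : Prop :=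
  simplex x /\
  (ereal_sup
     [set e | exists2 mu : probability (Rp R p) R, ambiguity S B mu
        & e = 'E_mu[fun xi : Rp R p => loss a b (- returns r x xi - t)]]
   <= lambda%:E)%E.

Definition dro_feasible (lambda : R) (a b : 'I_m.+1 -> R)
    (r : 'I_n -> mpoly p R) (d : nat) (S : set 'rV[R]_p) (B : set (tms R p d))
    (t : R) (x : 'cV[R]_n) : Prop :=
  simplex x /\
  forall mu : 'I_m.+1 -> {finite_measure set (Rp R p) -> \bar R},
    (forall j, supported S (mu j)) ->
    (exists2 nu : probability (Rp R p) R, ambiguity S B nu
       & forall A, measurable A -> nu A = (\sum_(j < m.+1) mu j A)%E) ->
    0 <= \sum_(j < m.+1)
           Rintegral (mu j) setT (fun xi : Rp R p => fpiece lambda a b r j t x xi).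

End Problems.

Section Relaxations.
Variables (R : realType) (n p m m1 d : nat).
Variables (g : 'I_m1 -> mpoly p R) (B : set (tms R p d)) (a : 'I_m.+1 -> R).
Variables (A : 'I_m.+1 -> 'M[R]_(nexp p d, n)) (c : 'I_m.+1 -> tms R p d).

Record primal_point := PrimalPoint {
  pp_t : R;
  pp_x : 'cV[R]_n;
  pp_w : tms R p d }.

Record dual_point (k : nat) := DualPoint {
  dp_gamma0 : R;
  dp_gamma : 'cV[R]_n;
  dp_y : 'I_m.+1 -> tms R p d;
  dp_z : 'I_m.+1 -> tms R p (2 * k) }.

(* The coefficient vector a_j e_1 t + A_j x + c_j of f_j(t, x, lambda, _). *)
Definition fcoef (j : 'I_m.+1) (t : R) (x : 'cV[R]_n) : tms R p d :=
  (a j * t) *: e1 d + A j *m x + c j.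

Definition primal_feasible (k : nat) (P : primal_point) : Prop :=
  [/\ simplex (pp_x P),
      add_sets (qmodule g k) (dual_cone B) (poly_of (pp_w P))
    & forall j,
        qmodule g k (poly_of (fcoef j (pp_t P) (pp_x P) - pp_w P : tms R p d))].

Definition primal_optimizer (k : nat) (P : primal_point) : Prop :=
  primal_feasible k P /\
  forall P', primal_feasible k P' -> pp_t P <= pp_t P'.

Definition dual_value (gamma0 : R) (y : 'I_m.+1 -> tms R p d) : R :=
  gamma0 - \sum_(j < m.+1) dot (c j) (y j).

Definition dual_feasible (k : nat) (D : dual_point k) : Prop :=
  [/\ (forall i, 0 <= dp_gamma D i 0),
      \sum_(j < m.+1) a j * dot (e1 d) (dp_y D j) = 1,
      const_mx (dp_gamma0 D) + dp_gamma D
        + \sum_(j < m.+1) (A j)^T *m dp_y D j = 0,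
      (forall j, dp_y D j = trunc d (dp_z D j)
                 /\ moment_relax g k (dp_z D j))
    & cone B (\sum_(j < m.+1) dp_y D j) /\
      moment_relax g k (\sum_(j < m.+1) dp_z D j : tms R p (2 * k))].

Definition dual_optimizer (k : nat) (D : dual_point k) : Prop :=
  dual_feasible D /\
  forall D' : dual_point k, dual_feasible D' ->
    dual_value (dp_gamma0 D') (dp_y D') <= dual_value (dp_gamma0 D) (dp_y D).

End Relaxations.

Section Algorithm.
Variables (R : realType) (n p m m1 d : nat).
Variables (g : 'I_m1 -> mpoly p R) (B : set (tms R p d)) (a : 'I_m.+1 -> R).
Variables (A : 'I_m.+1 -> 'M[R]_(nexp p d, n)) (c : 'I_m.+1 -> tms R p d).
Variable rho : mpoly p R.

Let t0 := uphalf d.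
Let tc := uphalf (deg_tuple g).

Definition extension_feasible (y : tms R p d) (l : nat) (v : tms R p (2 * l)) :
    Prop :=
  trunc d v = y /\ moment_relax g l v.

Definition extension_minimizer (y : tms R p d) (l : nat) (v : tms R p (2 * l)) :
    Prop :=
  extension_feasible y v /\
  forall v' : tms R p (2 * l), extension_feasible y v' ->
    pairing rho v <= pairing rho v'.

Definition flat (l : nat) (v : tms R p (2 * l)) : Prop :=
  exists s : nat, [/\ (maxn t0 tc <= s)%N, (s <= l)%N
    & \rank (moment_mx (s - tc) v) = \rank (moment_mx s v)].

(* For each index j, the current relaxation order l_j and, once it has been
   computed at that order, the minimizer v_j. *)
Inductive ext_status : Type :=
  | Pending (l : nat)
  | Computed (l : nat) (v : tms R p (2 * l)).

Definition ext_order (s : ext_status) : nat :=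
  match s with Pending l => l | Computed l _ => l end.

Inductive alg_state : Type :=
  | AtStep1 (k : nat) (l : 'I_m.+1 -> nat)
  | AtStep2 (k : nat) (P : primal_point R n p d) (D : dual_point R n p m d k)
      (st : 'I_m.+1 -> ext_status)
  | AtStep3 (k : nat) (P : primal_point R n p d) (D : dual_point R n p m d k)
      (st : 'I_m.+1 -> ext_status)
  | Terminated (P : primal_point R n p d) (gamma0 : R) (gamma : 'cV[R]_n)
      (y : 'I_m.+1 -> tms R p d).

(* Step 2 only deals with the indices j that are pending, i.e. those which have
   not been solved for the current y_j or which Step 3 has sent back.  The orders
   l_j are kept when k is increased. *)
Inductive alg_step : alg_state -> alg_state -> Prop :=
  | step1_solve k l P (D : dual_point R n p m d k) :
      primal_optimizer g B a A c k P -> dual_optimizer g B a A c D ->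
      alg_step (AtStep1 k l) (AtStep2 P D (fun j => Pending (l j)))
  | step2_infeasible k P (D : dual_point R n p m d k) st j l :
      dp_y D j != 0 -> st j = Pending l ->
      (forall v : tms R p (2 * l), ~ extension_feasible (dp_y D j) v) ->
      alg_step (AtStep2 P D st) (AtStep1 k.+1 (fun i => ext_order (st i)))
  | step2_solve k P (D : dual_point R n p m d k) st st' :
      (forall j, dp_y D j != 0 -> forall l, st j = Pending l ->
         exists2 v : tms R p (2 * l), extension_minimizer (dp_y D j) v
           & st' j = Computed v) ->
      (forall j, (dp_y D j = 0 \/ exists l (v : tms R p (2 * l)),
                    st j = Computed v) ->
         st' j = st j) ->
      alg_step (AtStep2 P D st) (AtStep3 P D st')
  | step3_not_flat k P (D : dual_point R n p m d k) st j l
        (v : tms R p (2 * l)) :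
      dp_y D j != 0 -> st j = Computed v -> ~ flat v ->
      alg_step (AtStep3 P D st)
        (AtStep2 P D (fun i => if i == j then Pending l.+1 else st i))
  | step4_return k P (D : dual_point R n p m d k) st
        (mu : {finite_measure set (Rp R p) -> \bar R}) :
      (forall j, dp_y D j != 0 ->
         exists l (v : tms R p (2 * l)), st j = Computed v /\ flat v) ->
      let ystar : tms R p d := \sum_(j < m.+1) dp_y D j in
      finitely_atomic mu -> supported (semialg_set g) mu ->
      moments d mu = (entry ystar mnm0)^-1 *: ystar ->
      alg_step (AtStep3 P D st)
        (Terminated P (dp_gamma0 D) (dp_gamma D) (dp_y D)).

Definition alg_init : alg_state :=
  let k := maxn t0 tc in AtStep1 k (fun=> k.+1).

Definition terminates_with (P : primal_point R n p d) (gamma0 : R)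
    (gamma : 'cV[R]_n) (y : 'I_m.+1 -> tms R p d) : Prop :=
  clos_refl_trans_1n _ alg_step alg_init (Terminated P gamma0 gamma y).

End Algorithm.

(* Main.v *)
Require Import Defs.
From HB Require Import structures.
From mathcomp Require Import all_boot all_order all_algebra.
From mathcomp Require Import all_classical all_reals all_analysis.
From mathcomp Require Import measurable_realfun.
From mathcomp Require Import complex.
From mathcomp Require Import ring lra zify.
From mathcomp Require mpoly.
Import -(notations) mpoly.
Import Order.TTheory GRing.Theory Num.Theory.
Import numFieldNormedType.Exports.
Local Open Scope classical_set_scope.
Local Open Scope ring_scope.

(** The proof is weak duality between the robust problem and the relaxation
    (D_k), made exact by the stopping test of the algorithm.

    Feasibility of (tstar, xstar).  Elements of the quadratic module are
    nonnegative on S, so the primal certificates say that f_j >= w^T [xi]_d on S for every j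
    and that the integral of w^T [xi]_d against any measure of the ambiguity set
    is nonnegative.  Summing the integrals of the f_j against a decomposition
    of such a measure gives the robust constraint ([primal_feasible_dro]).

    Optimality.  Let (t, x) satisfy the robust constraint.  If each y_j has a
    representing measure on S, then after normalization these measures
    decompose a member of the ambiguity set: the sum of the y_j lies in the cone
    K generated by the moment vectors of the ambiguity set, and B is convex.
    The robust constraint then reads
    sum_j <f_j(t, x, lambda, _), y_j> >= 0, and the linear equations
    of (D_k) turn this into t >= gamma_0 - sum_j c_j^T y_j
    ([weak_duality]), which is tstar by the equality of the two values.

    So everything rests on the existence of representing measures, which is the
    flat extension theorem of Curto and Fialkow
    ([flat_extension_moment_cone]).  Let L be the Riesz functional of an
    extension v of y_j with M_s positive semidefinite and
    rank M_(s - tc) = rank M_s.  Polynomials of degree at most s modulo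
    the kernel of M_s form a Euclidean space H for <q, h> = L(q h).  By
    flatness every class has a representative of degree at most s - tc < s, so
    multiplication by each variable is a well defined operator on H; these
    operators are self-adjoint and commute, hence are simultaneously
    diagonalizable over the reals.  The joint eigenvalues are the atoms, and the
    decomposition of the class of 1 along the joint eigenvectors gives the
    weights.  An eigenvector is the class of some q of degree at most s - tc
    which vanishes at all the atoms but its own, so positivity of the localizing
    matrices, in the form L(g_i q^2) >= 0, puts every atom in S.  When tc = 0
    the rank condition is void, but then the g_i are constant and compactness of
    S leaves only degenerate cases.

    The equivalence with the original problem holds because the loss is the
    maximum of its affine pieces: the best decomposition of a measure restricts
    it, for each j, to the region where the piece j attains the maximum. *)

Set Implicit Arguments.
Unset Strict Implicit.
Unset Printing Implicit Defensive.

(** * Simultaneous diagonalization of commuting self-adjoint matrices *)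

Definition posdefmx (R : realDomainType) (n : nat) (G : 'M[R]_n) : Prop :=
  G^T = G /\ forall u : 'rV_n, u != 0 -> 0 < (u *m G *m u^T) 0 0.

Lemma posdefmx_ge0 (R : realDomainType) (n : nat) (G : 'M[R]_n) (u : 'rV_n) :
  posdefmx G -> 0 <= (u *m G *m u^T) 0 0.
Proof.
case=> _ Gpos; have [->|/Gpos/ltW//] := eqVneq u 0.
by rewrite !mul0mx mxE.
Qed.

Lemma posdefmx_eq0 (R : realDomainType) (n : nat) (G : 'M[R]_n) (u : 'rV_n) :
  posdefmx G -> (u *m G *m u^T) 0 0 = 0 -> u = 0.
Proof. by case=> _ Gpos uGu; apply/eqP; apply: contra_eqT uGu => /Gpos/gt_eqF->. Qed.

Lemma posdefmx_unit (R : realFieldType) (n : nat) (G : 'M[R]_n) :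
  posdefmx G -> G \in unitmx.
Proof.
move=> Gpos; rewrite -row_free_unit -kermx_eq0; apply/eqP/row_matrixP => i.
rewrite row0; apply: (posdefmx_eq0 Gpos).
by rewrite -row_mul mulmx_ker row0 mul0mx mxE.
Qed.

(** The classical argument for Hermitian matrices, with the real and imaginary
    parts x and y of an eigenvector kept apart: comparing <xT, y> with <x, yT>
    leaves Im z (<x, x> + <y, y>) = 0. *)
Lemma selfadjoint_eigenvalue_real (R : rcfType) (n : nat) (G T : 'M[R]_n)
    (z : complex R) :
  posdefmx G -> (T *m G)^T = T *m G ->
  eigenvalue (map_mx (real_complex R) T) z -> complex.Im z = 0.
Proof.
move=> Gpos TG /eigenvalueP [u uT u0].
pose x : 'rV[R]_n := \row_j complex.Re (u 0 j); pose y : 'rV[R]_n := \row_j complex.Im (u 0 j).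
have ReS (I : finType) (F : I -> complex R) : complex.Re (\sum_i F i) = \sum_i complex.Re (F i).
  by elim/big_rec2: _ => // i a b _ <-; case: (F i) b => ? ? [].
have ImS (I : finType) (F : I -> complex R) : complex.Im (\sum_i F i) = \sum_i complex.Im (F i).
  by elim/big_rec2: _ => // i a b _ <-; case: (F i) b => ? ? [].
have ReM (a b : complex R) :
    complex.Re (a * b) = complex.Re a * complex.Re b - complex.Im a * complex.Im b.
  by case: a; case: b.
have ImM (a b : complex R) :
    complex.Im (a * b) = complex.Re a * complex.Im b + complex.Im a * complex.Re b.
  by case: a; case: b.
have xT : x *m T = complex.Re z *: x - complex.Im z *: y.
  apply/rowP => j; move/rowP/(_ j)/(congr1 (@complex.Re R)): uT.
  rewrite !mxE ReS ReM => <-; apply: eq_bigr => i _.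
  by rewrite !mxE ReM /= mulr0 subr0.
have yT : y *m T = complex.Re z *: y + complex.Im z *: x.
  apply/rowP => j; move/rowP/(_ j)/(congr1 (@complex.Im R)): uT.
  rewrite !mxE ImS ImM => <-; apply: eq_bigr => i _.
  by rewrite !mxE ImM /= mulr0 add0r.
have [Gs _] := Gpos.
have adj : x *m T *m G *m y^T = x *m G *m (y *m T)^T.
  by rewrite trmx_mul !mulmxA -(mulmxA x T G) -TG trmx_mul Gs !mulmxA.
have key : complex.Im z * ((x *m G *m x^T) 0 0 + (y *m G *m y^T) 0 0) = 0.
  move: adj; rewrite xT yT !mulmxBl -!scalemxAl [(_ + _)^T]linearD /= mulmxDr.
  rewrite ![(_ *: _)^T]linearZ /= -!scalemxAr => /matrixP/(_ 0 0).
  by rewrite !mxE => /addrI/esym/eqP; rewrite -subr_eq0 opprK -mulrDr => /eqP.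
move/eqP: key; rewrite mulf_eq0 => /orP[/eqP//|].
rewrite paddr_eq0 ?posdefmx_ge0// => /andP[/eqP/(posdefmx_eq0 Gpos) x0].
move=> /eqP/(posdefmx_eq0 Gpos) y0; case/eqP: u0; apply/rowP => j.
move/rowP/(_ j): x0; move/rowP/(_ j): y0; rewrite !mxE.
by case: (u 0 j) => ? ? /= -> ->.
Qed.

(** If v T^2 = 0 then <vT, vT> = <v T^2, v> = 0; this is what excludes multiple
    roots of the minimal polynomial of T. *)
Lemma selfadjoint_sqr_ker (R : realDomainType) (n : nat) (G T N : 'M[R]_n) :
  posdefmx G -> (T *m G)^T = T *m G -> N *m T *m T = 0 -> N *m T = 0.
Proof.
move=> Gpos TG NTT; apply/row_matrixP => i; rewrite row0.
have [Gs _] := Gpos; apply: (posdefmx_eq0 Gpos); rewrite row_mul.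
set v := row i N; rewrite trmx_mul !mulmxA.
have -> : v *m T *m G *m T^T = v *m T *m (T *m G).
  by rewrite -TG trmx_mul Gs !mulmxA.
rewrite !mulmxA -(_ : row i (N *m T *m T) = v *m T *m T); first last.
  by rewrite !row_mul.
by rewrite NTT row0 !mul0mx mxE.
Qed.

(** The minimal polynomial splits over R[i]; its roots are eigenvalues, hence
    real, and they are simple. *)
Lemma selfadjoint_diagonalizable (R : rcfType) (n : nat) (G T : 'M[R]_n) :
  posdefmx G -> (T *m G)^T = T *m G -> diagonalizable T.
Proof.
case: n G T => [|n] G T Gpos TG; first by rewrite (thinmx0 T); apply: diagonalizable0.
apply/diagonalizableP; set p := mxminpoly T.
pose f := real_complex R.
have [rs prs] := closed_field_poly_normal (map_poly f p).
have pm : p \is monic := mxminpoly_monic T.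
rewrite (monicP _) ?map_monic// scale1r in prs.
have rs_real z : z \in rs -> f (complex.Re z) = z.
  move=> zrs; have : root (map_poly f p) z by rewrite prs root_prod_XsubC.
  rewrite -mxminpoly_map -eigenvalue_root_min.
  by move/(selfadjoint_eigenvalue_real Gpos TG); case: z {zrs} => a b /= ->.
pose evs := [seq complex.Re z | z <- rs].
have pE : p = \prod_(x <- evs) ('X - x%:P).
  apply: (map_poly_inj f); rewrite prs rmorph_prod /= big_map.
  rewrite !big_seq; apply: eq_bigr => z /rs_real {1}<-.
  by rewrite rmorphB /= map_polyX map_polyC.
exists evs; last by rewrite pE.
apply/negPn/negP => nu.
(* A repeated root a would make (X - a) h a smaller annihilating polynomial. *)
have [a ain ar] : exists2 a, a \in evs & a \in rem a evs.
  move: nu; elim: evs {pE} => //= x s IHs; rewrite negb_and negbK.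
  case/orP=> [xs|/IHs [a ain ar]]; first by exists x; rewrite ?mem_head//= eqxx.
  by exists a; rewrite ?inE ?ain ?orbT//=; case: eqP => // _; rewrite inE ar orbT.
pose h := \prod_(x <- rem a (rem a evs)) ('X - x%:P).
have pE' : p = h * ('X - a%:P) * ('X - a%:P).
  rewrite pE (perm_big _ (perm_to_rem ain)) big_cons.
  rewrite (perm_big _ (perm_to_rem ar)) big_cons /= -/h.
  by rewrite mulrA mulrC mulrA.
have XE : horner_mx T ('X - a%:P) = T - a%:M.
  by rewrite rmorphB /= horner_mx_X horner_mx_C.
have sa : ((T - a%:M) *m G)^T = (T - a%:M) *m G.
  case: Gpos => Gs _.
  by rewrite mulmxBl linearB /= TG mul_scalar_mx linearZ /= Gs.
have : horner_mx T (h * ('X - a%:P)) = 0.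
  rewrite rmorphM /= XE; apply: (selfadjoint_sqr_ker Gpos sa).
  by have := mx_root_minpoly T; rewrite -/p pE' !rmorphM /= XE.
move=> /mxminpoly_min; rewrite -/p pE'.
have hn : h * ('X - a%:P) != 0.
  apply/eqP => h0; move: pm; rewrite pE' h0 mul0r => /monic_neq0.
  by rewrite eqxx.
by move/(dvdp_leq hn); rewrite size_Mmonic ?monicXsubC// size_XsubC addn2 /= ltnn.
Qed.

(** Rows of P are joint eigenvectors.  They are not orthonormalized: in the
    application the joint eigenvalues are pairwise distinct, which makes the
    rows orthogonal. *)
Lemma commuting_selfadjoint_diag (R : rcfType) (n : nat) (I : finType)
    (G : 'M[R]_n) (T : I -> 'M[R]_n) :
  posdefmx G -> (forall i, (T i *m G)^T = T i *m G) ->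
  (forall i j, T i *m T j = T j *m T i) ->
  exists2 P : 'M[R]_n, P \in unitmx &
    exists D : I -> 'rV[R]_n, forall i, P *m T i = diag_mx (D i) *m P.
Proof.
move=> Gpos TG TC; have := @codiagonalizableP _ n [seq T i | i <- enum I].
case=> + _; case.
  split=> [_ _ /mapP[i _ ->] /mapP[j _ ->]|_ /mapP[i _ ->]].
    exact: TC.
  exact: selfadjoint_diagonalizable Gpos (TG i).
move=> P Pu /allP PD; exists P => //.
have D i : {d : 'rV[R]_n | P *m T i = diag_mx d *m P}.
  apply/cid; have /PD : T i \in [seq T i | i <- enum I].
    by apply: map_f; rewrite mem_enum.
  by move=> /diagonalizable_forPex[d /(simmxP Pu)]; exists d.
by exists (fun i => sval (D i)) => i; case: (D i).
Qed.

(** * Polynomials of bounded degree *)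

Section Degree.
Variables (R : realType) (p : nat).
Implicit Types (q h : mpoly p R) (d : nat).

Lemma polys_uptoE d q : polys_upto d q <-> (msize q <= d.+1)%N.
Proof. by rewrite /polys_upto /deg /=; case: (msize q). Qed.

Lemma polys_upto0 d : polys_upto d (0 : mpoly p R).
Proof. by apply/polys_uptoE; rewrite mmeasure0. Qed.

Lemma polys_uptoD d q h : polys_upto d q -> polys_upto d h -> polys_upto d (q + h).
Proof.
move=> /polys_uptoE hq /polys_uptoE hh; apply/polys_uptoE.
by rewrite (leq_trans (mmeasureD_le _ _ _))// geq_max hq.
Qed.

Lemma polys_uptoZ d x q : polys_upto d q -> polys_upto d (x *: q).
Proof.
by move=> /polys_uptoE hq; apply/polys_uptoE; rewrite (leq_trans (msizeZ_le _ _)).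
Qed.

Lemma polys_upto_sum d (I : Type) (r : seq I) (P : pred I) (F : I -> mpoly p R) :
  (forall i, P i -> polys_upto d (F i)) -> polys_upto d (\sum_(i <- r | P i) F i).
Proof.
move=> hF; elim/big_ind: _ => //; first exact: polys_upto0.
exact: polys_uptoD.
Qed.

Lemma polys_uptoX d m : (mdeg m <= d)%N -> polys_upto d (mpolyX R m : mpoly p R).
Proof. by move=> md; apply/polys_uptoE; rewrite msizeX. Qed.

Lemma polys_uptoW d e q : (d <= e)%N -> polys_upto d q -> polys_upto e q.
Proof. by rewrite /polys_upto /= => de /leq_trans; apply. Qed.

Lemma polys_uptoM d e q h :
  polys_upto d q -> polys_upto e h -> polys_upto (d + e) (q * h).
Proof.
have [->|q0] := eqVneq q 0; first by rewrite mul0r => _ _; apply: polys_upto0.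
have [->|h0] := eqVneq h 0; first by rewrite mulr0 => _ _; apply: polys_upto0.
move=> /polys_uptoE hq /polys_uptoE hh; apply/polys_uptoE.
rewrite msizeM//; move: (msize q) (msize h) hq hh => a b hq hh; lia.
Qed.

(** Linear identities between polynomials of bounded degree need only be
    checked on monomials. *)
Lemma polys_upto_ind d (P : mpoly p R -> Prop) :
  P 0 -> (forall q h, P q -> P h -> P (q + h)) ->
  (forall x m, (mdeg m <= d)%N -> P (x *: mpolyX R m)) ->
  forall q, polys_upto d q -> P q.
Proof.
move=> P0 PD PX q /polys_uptoE hq; rewrite (mpolyE q) big_seq.
elim/big_ind: _ => // m /msize_mdeg_lt mq; apply: PX.
by rewrite -ltnS (leq_trans mq).
Qed.

End Degree.

Lemma mdeg_gt0_unit (p : nat) (m : multinom p) :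
  m != mnm0 -> exists i, lem (mnm1 i) m.
Proof.
rewrite -mdeg_eq0 mdegE => m0; have [i mi] : exists i, (0 < m i)%N.
  apply/existsP; apply: contraNT m0; rewrite negb_exists => /forallP m0.
  by rewrite big1// => i _; apply/eqP; move: (m0 i); rewrite -eqn0Ngt.
by exists i; apply/mnm_lepP => j; rewrite mnm1E; case: eqP => // <-.
Qed.

Lemma mdeg_split (p : nat) (m : multinom p) (d e : nat) : (mdeg m <= d + e)%N ->
  exists m1 m2 : multinom p,
    [/\ m = mnm_add m1 m2, (mdeg m1 <= d)%N & (mdeg m2 <= e)%N].
Proof.
elim: d e => [|d IHd] e.
  by exists mnm0, m; rewrite add0m mdeg0.
rewrite addSnnS => /IHd[m1 [m2 [mE m1d m2e]]].
have [{}m2e|m2e'] := leqP (mdeg m2) e; first by exists m1, m2; split; rewrite // ltnW.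
have [|i im2] := @mdeg_gt0_unit _ m2; first by rewrite -mdeg_eq0; lia.
exists (mnm_add m1 (mnm1 i)), (mnm_sub m2 (mnm1 i)); split.
- by rewrite mE -{1}(submK im2) -addmA; congr mnm_add; rewrite addmC.
- by rewrite mdegD mdeg1; lia.
- by move: m2e; rewrite -{1}(submK im2) mdegD mdeg1; lia.
Qed.

(** * Representing measure of a flat functional *)

(** Flatness enters as the existence of a family b of degree at most t < s which
    spans the polynomials of degree at most s modulo the kernel of the form
    L(q h), and on which this form is positive definite.  With no variable
    there is nothing to multiply by, whence the form of the strict inequality. *)
Section FlatFunctional.
Variables (R : realType) (p : nat) (L : {scalar (mpoly p R)}).
Variables (s t rho : nat) (b : 'I_rho -> mpoly p R).
Hypothesis ts : (t <= s)%N.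
Hypothesis t_lt_s : forall i : 'I_p, (t < s)%N.
Hypothesis b_upto : forall k, polys_upto t (b k).

Let G : 'M[R]_rho := \matrix_(k, l) L (b k * b l).

Hypothesis G_posdef : posdefmx G.
Hypothesis b_spans : forall q, polys_upto s q -> exists w : 'I_rho -> R,
  forall h, polys_upto s h -> L (q * h) = \sum_k w k * L (b k * h).

Let G_unit : G \in unitmx := posdefmx_unit G_posdef.
Let b_upto_s k : polys_upto s (b k) := polys_uptoW ts (b_upto k).

(** Coordinates in the family b of the class of q modulo the kernel of L. *)
Let coords (q : mpoly p R) : 'rV[R]_rho := (\row_l L (q * b l)) *m invmx G.

Let coordsG q : coords q *m G = \row_l L (q * b l).
Proof. by rewrite mulmxKV. Qed.

Let coordsD q h : coords (q + h) = coords q + coords h.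
Proof.
rewrite -mulmxDl; congr (_ *m _); apply/rowP => l.
by rewrite !mxE mulrDl linearD.
Qed.

Let coordsZ x q : coords (x *: q) = x *: coords q.
Proof.
rewrite scalemxAl; congr (_ *m _); apply/rowP => l.
by rewrite !mxE -scalerAl linearZ.
Qed.

Let coords0 : coords 0 = 0.
Proof. by have := coordsZ 0 0; rewrite !scale0r. Qed.

Let coordsP q h : polys_upto s q -> polys_upto s h ->
  L (q * h) = \sum_k coords q 0 k * L (b k * h).
Proof.
move=> /b_spans[w qw] hh; rewrite qw//; apply: eq_bigr => k _; congr (_ * _).
suff -> : coords q = \row_k w k by rewrite mxE.
rewrite -[RHS](mulmxK G_unit); congr (_ *m _); apply/rowP => l; rewrite !mxE qw//.
by apply: eq_bigr => j _; rewrite !mxE.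
Qed.

Let coords_form q h : polys_upto s q -> polys_upto s h ->
  L (q * h) = (coords q *m G *m (coords h)^T) 0 0.
Proof.
move=> hq hh; rewrite mulrC coordsP// coordsG mxE; apply: eq_bigr => k _.
by rewrite !mxE mulrC (mulrC q).
Qed.

Let coords_b k : coords (b k) = delta_mx 0 k.
Proof.
have -> : delta_mx 0 k = row k (1%:M : 'M[R]_rho) by rewrite rowE mulmx1.
by rewrite -(mulmxV G_unit) row_mul; congr (_ *m _); apply/rowP => l; rewrite !mxE.
Qed.

Let coords_sum (u : 'rV[R]_rho) : coords (\sum_k u 0 k *: b k) = u.
Proof.
rewrite [RHS]row_sum_delta; elim/big_rec2: _ => // k u' q _ IH.
by rewrite coordsD IH coordsZ coords_b.
Qed.

(** Multiplication by the variable i, as a form and as an operator. *)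
Let X i : 'M[R]_rho := \matrix_(k, l) L (mpolyX R (mnm1 i) * b k * b l).
Let T i := X i *m invmx G.

Let upto_shift i k : polys_upto s (mpolyX R (mnm1 i) * b k).
Proof.
apply: (@polys_uptoW _ _ (1 + t)); first by rewrite add1n t_lt_s.
by apply: polys_uptoM => //; apply: polys_uptoX; rewrite mdeg1.
Qed.

Let coords_shift i q : polys_upto s q -> polys_upto s (mpolyX R (mnm1 i) * q) ->
  coords (mpolyX R (mnm1 i) * q) = coords q *m T i.
Proof.
move=> hq hXq; rewrite mulmxA; congr (_ *m _); apply/rowP => l.
rewrite [LHS]mxE [RHS]mxE mulrAC mulrC coordsP//; apply: eq_bigr => k _.
by rewrite [X i k l]mxE mulrCA mulrA.
Qed.

Let TG i : (T i *m G)^T = T i *m G.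
Proof.
rewrite mulmxKV//; apply/matrixP => k l; rewrite !mxE.
by rewrite -!mulrA [b l * _]mulrC.
Qed.

Let row_T i k : row k (T i) = coords (mpolyX R (mnm1 i) * b k).
Proof. by rewrite coords_shift// coords_b rowE. Qed.

(** Both products represent the form L(x_i x_j b_k b_l). *)
Let T_comm i j : T i *m T j = T j *m T i.
Proof.
suff H i' j' : T i' *m T j' *m G =
    \matrix_(k, l) L (mpolyX R (mnm1 i') * mpolyX R (mnm1 j') * b k * b l).
  apply: (can_inj (mulmxK G_unit)); rewrite !H.
  by apply/matrixP => k l; rewrite !mxE [mpolyX R (mnm1 i) * _]mulrC.
apply/matrixP => k l; rewrite [RHS]mxE.
have -> : mpolyX R (mnm1 i') * mpolyX R (mnm1 j') * b k * b l =
    (mpolyX R (mnm1 i') * b k) * (mpolyX R (mnm1 j') * b l) by ring.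
rewrite coords_form// -!row_T.
have [Gs _] := G_posdef.
have -> : T i' *m T j' *m G = T i' *m G *m (T j')^T.
  by rewrite -mulmxA -TG trmx_mul Gs mulmxA.
by rewrite tr_row colE mulmxA -!row_mul -colE [RHS]mxE [RHS]mxE.
Qed.

(** The atoms are the joint eigenvalues xi of the multiplications.  The third
    clause locates them: the k-th joint eigenvector is the class of a polynomial q
    of degree at most t vanishing at the other atoms, so that L(f q^2) is a
    positive multiple of f(xi k). *)
Theorem flat_functional_atoms :
  exists (c : 'I_rho -> R) (xi : 'I_rho -> 'rV[R]_p),
    [/\ forall k, 0 <= c k,
        forall q, polys_upto (s + s) q -> L q = \sum_k c k * meval (xi k 0) q
      & forall k e (f : mpoly p R), polys_upto e f -> (e + (t + t) <= s + s)%N ->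
          (forall q, polys_upto t q -> 0 <= L (f * q * q)) ->
          0 <= meval (xi k 0) f].
Proof.
have [P Pu [D PD]] := commuting_selfadjoint_diag G_posdef TG T_comm.
pose xi k : 'rV[R]_p := \row_i D i 0 k.
(* Coordinates of the class of 1 along the joint eigenvectors. *)
pose a : 'rV[R]_rho := coords 1 *m invmx P.
have PT i u : u *m T i *m invmx P = u *m invmx P *m diag_mx (D i).
  by rewrite -{1}(mulmxKV Pu u) -(mulmxA _ P) PD !mulmxA mulmxK.
(* The class of q is q(T) applied to the class of 1, whence its coordinates. *)
have coords_eval q k : polys_upto s q ->
    (coords q *m invmx P) 0 k = a 0 k * meval (xi k 0) q.
  move: q; apply: polys_upto_ind.
  - by rewrite coords0 mul0mx mxE meval0 mulr0.
  - by move=> q h IHq IHh; rewrite coordsD mulmxDl mxE IHq IHh mevalD mulrDr.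
  move=> x m md; rewrite coordsZ -scalemxAl mxE mevalZ mulrCA; congr (_ * _).
  have [n] := ubnP (mdeg m); elim: n m md => // n IHn m md.
  rewrite ltnS => mn; have [m0|m_neq0] := eqVneq m mnm0.
    by rewrite m0 mpolyX0 meval1 mulr1.
  have [i mi] := mdeg_gt0_unit m_neq0.
  have mdE : mdeg m = (1 + mdeg (mnm_sub m (mnm1 i)))%N.
    by rewrite -{1}(submK mi) mdegD mdeg1 addnC.
  rewrite -(submK mi) addmC mpolyXD coords_shift; first last.
  - by rewrite -mpolyXD; apply: polys_uptoX; rewrite mdegD mdeg1 -mdE.
  - by apply: polys_uptoX; lia.
  rewrite PT mul_mx_diag mxE IHn; [|lia..].
  by rewrite mevalM mevalXU [xi k 0 i]mxE; ring.
(* q_ k represents the k-th joint eigenvector. *)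
pose q_ k := \sum_j row k P 0 j *: b j.
have q_upto k : polys_upto t (q_ k).
  by apply: polys_upto_sum => j _; apply: polys_uptoZ.
have a_q k l : a 0 l * meval (xi l 0) (q_ k) = (k == l)%:R.
  rewrite -coords_eval; last exact: polys_uptoW (q_upto k).
  by rewrite coords_sum -row_mul mulmxV// !mxE.
pose W := P *m G *m P^T.
have [Gs _] := G_posdef.
(* The class of 1 is cyclic, so distinct eigenvectors have distinct joint
   eigenvalues, and are therefore orthogonal. *)
have W_diag k l : k != l -> W k l = 0.
  move=> kl; have [i Di] : exists i, D i 0 k != D i 0 l.
    apply/existsP; apply: contraT; rewrite negb_exists => /forallP Dkl.
    have xikl : xi k = xi l.
      by apply/rowP => i; rewrite !mxE; move: (Dkl i); rewrite negbK => /eqP.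
    have := a_q k k; have := a_q k l; rewrite xikl (negPf kl) eqxx => /eqP.
    rewrite mulf_eq0 => /orP[/eqP al|/eqP->]; last first.
      by rewrite mulr0 => /eqP; rewrite eq_sym oner_eq0.
    by have := a_q l l; rewrite eqxx al mul0r => /eqP; rewrite eq_sym oner_eq0.
  have DW : diag_mx (D i) *m W = W *m diag_mx (D i).
    have -> : diag_mx (D i) *m W = P *m (T i *m G) *m P^T.
      by rewrite (mulmxA P (T i) G) PD /W !mulmxA.
    rewrite -(TG i) [(T i *m G)^T]trmx_mul Gs -!mulmxA -trmx_mul PD.
    by rewrite trmx_mul tr_diag_mx !mulmxA.
  have /eqP := congr1 (fun M : 'M[R]_rho => M k l) DW.
  rewrite mul_diag_mx mul_mx_diag mxE [in X in _ == X]mxE mulrC -subr_eq0 -mulrBr.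
  by rewrite mulf_eq0 subr_eq0 (negPf Di) orbF => /eqP.
have W_gt0 k : 0 < W k k.
  have -> : W k k = (row k P *m G *m (row k P)^T) 0 0.
    by rewrite tr_row colE mulmxA -!row_mul -colE [RHS]mxE [RHS]mxE.
  apply: G_posdef.2; apply/eqP => Pk0.
  have := congr1 (fun u : 'rV_rho => (u *m invmx P) 0 k) Pk0.
  by rewrite -row_mul mulmxV// mul0mx !mxE eqxx => /eqP; rewrite oner_eq0.
have WE : P *m G *m P^T = W by [].
clearbody W a xi; pose c k := a 0 k ^+ 2 * W k k.
have L_atoms q h : polys_upto s q -> polys_upto s h ->
    L (q * h) = \sum_k c k * meval (xi k 0) (q * h).
  move=> hq hh; rewrite coords_form//.
  rewrite -(mulmxKV Pu (coords q)) -(mulmxKV Pu (coords h)).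
  rewrite trmx_mul !mulmxA -(mulmxA _ P) -(mulmxA _ (P *m G)) WE.
  rewrite mxE; apply: eq_bigr => k _; rewrite mxE (bigD1 k) //= big1 => [|l lk].
    rewrite addr0 [_^T _ _]mxE !coords_eval// mevalM /c.
    by move: (meval _ q) (meval _ h) (W k k) (a 0 k) => x y z u; ring.
  by rewrite W_diag ?mulr0.
have L_eval q : polys_upto (s + s) q -> L q = \sum_k c k * meval (xi k 0) q.
  move: q; apply: polys_upto_ind.
  - by rewrite linear0 big1 // => k _; rewrite meval0 mulr0.
  - move=> q h IHq IHh; rewrite linearD IHq IHh -big_split.
    by apply: eq_bigr => k _; rewrite mevalD mulrDr.
  move=> x m /mdeg_split[m1 [m2 [-> m1s m2s]]].
  rewrite linearZ /= mpolyXD L_atoms; [|exact: polys_uptoX..].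
  by rewrite mulr_sumr; apply: eq_bigr => k _; rewrite mevalZ mulrCA.
exists c, xi; split=> //.
  by move=> k; apply: mulr_ge0; [exact: sqr_ge0|exact: ltW].
move=> k e f hf est Lf; have := Lf _ (q_upto k).
rewrite L_eval => [|]; last first.
  apply: polys_uptoW est _; rewrite -mulrA; apply: polys_uptoM => //.
  exact: polys_uptoM.
have -> : \sum_l c l * meval (xi l 0) (f * q_ k * q_ k) = W k k * meval (xi k 0) f.
  rewrite (bigD1 k)//= big1 => [|l lk].
    rewrite addr0 !mevalM /c -[RHS]mulr1 -(expr1n _ 2) -[1 in RHS](_ : (k == k)%:R = 1).
      by rewrite -a_q; ring.
    by rewrite eqxx.
  rewrite !mevalM /c.
  have -> : a 0 l ^+ 2 * W l l * (meval (xi l 0) f * meval (xi l 0) (q_ k) *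
      meval (xi l 0) (q_ k)) =
      (a 0 l * meval (xi l 0) (q_ k)) ^+ 2 * (W l l * meval (xi l 0) f) by ring.
  by rewrite a_q eq_sym (negPf lk) expr0n mul0r.
by rewrite pmulr_rge0.
Qed.

End FlatFunctional.

(** * Flat truncated multi-sequences *)

Section FlatTms.
Variables (R : realType) (p : nat).

(** The pairing as a function of the polynomial, so that it can carry a linear
    structure. *)
Definition riesz (e : nat) (z : tms R p e) (q : mpoly p R) : R := pairing q z.

Lemma riesz_is_scalar (e : nat) (z : tms R p e) : scalar (riesz z).
Proof.
move=> x q h; rewrite /riesz /pairing mulr_sumr -big_split /=.
by apply: eq_bigr => i _; rewrite mcoeffD mcoeffZ mulrDl mulrA.
Qed.

HB.instance Definition _ (e : nat) (z : tms R p e) :=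
  GRing.isLinear.Build R (mpoly p R) R *%R (riesz z) (riesz_is_scalar z).

Lemma riesz_monomial (e : nat) (z : tms R p e) (m : multinom p) :
  riesz z (mpolyX R m) = entry z m.
Proof.
rewrite /riesz /pairing /entry [RHS]big_mkcond; apply: eq_bigr => i _.
by rewrite mcoeffX eq_sym; case: eqP => _; rewrite ?mul1r ?mul0r.
Qed.

Lemma expo_mdeg (e : nat) (i : 'I_(nexp p e)) : (mdeg (expo i) <= e)%N.
Proof. by rewrite /expo; case: (enum_val i). Qed.

Lemma expo_surj (e : nat) (m : multinom p) :
  (mdeg m <= e)%N -> exists i : 'I_(nexp p e), expo i = m.
Proof.
move=> me; have me' : (mdeg m < e.+1)%N by [].
by exists (enum_rank (BMultinom me')); rewrite /expo enum_rankK.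
Qed.

Definition hankel_mx (k e : nat) (z : tms R p e) : 'M[R]_(nexp p k) :=
  \matrix_(i, j) riesz z (mpolyX R (expo i) * mpolyX R (expo j)).

Lemma deg1 : deg (1 : mpoly p R) = 0%N.
Proof. by rewrite /deg msize1. Qed.

Lemma rank_moment_mx (k e : nat) (z : tms R p e) :
  \rank (moment_mx k z) = \rank (hankel_mx k z).
Proof.
have rank_eq k' : k' = k -> \rank (\matrix_(i < nexp p k', j < nexp p k')
    pairing (1 * mpolyX R (expo i) * mpolyX R (expo j)) z) = \rank (hankel_mx k z).
  by move=> ->; congr (\rank _); apply/matrixP => i j; rewrite !mxE mul1r.
by apply: rank_eq; rewrite deg1 subn0.
Qed.

Lemma riesz_sqr_ge0 (k e : nat) (z : tms R p e) (q : mpoly p R) :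
  psdmx (moment_mx k z) -> polys_upto k q -> 0 <= riesz z (q * q).
Proof.
move=> [_ Mpos] qk; have := Mpos (vec _ q); rewrite localizing_mxP ?mul1r//.
all: by rewrite deg1 subn0.
Qed.

Lemma riesz_local_ge0 (f : mpoly p R) (k e : nat) (z : tms R p e) (q : mpoly p R) :
  psdmx (localizing_mx f k z) -> polys_upto (k - uphalf (deg f)) q ->
  0 <= riesz z (f * q * q).
Proof. by move=> [_ Mpos] qk; have := Mpos (vec _ q); rewrite localizing_mxP. Qed.

(** The Cauchy-Schwarz argument for a semidefinite form: L((x q + h)^2) is affine
    in x when L(q^2) = 0, and it is nonnegative. *)
Lemma riesz_sqr_eq0 (k e : nat) (z : tms R p e) (q h : mpoly p R) :
  psdmx (moment_mx k z) -> polys_upto k q -> polys_upto k h ->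
  riesz z (q * q) = 0 -> riesz z (q * h) = 0.
Proof.
move=> Mpos qk hk q0; set y := riesz z (q * h).
have quad x : 0 <= riesz z (h * h) + 2 * x * y.
  have := riesz_sqr_ge0 Mpos (polys_uptoD (polys_uptoZ x qk) hk).
  have -> : (x *: q + h) * (x *: q + h) =
      (x * x) *: (q * q) + ((x + x) *: (q * h) + h * h).
    by rewrite -!mul_mpolyC rmorphM rmorphD /=; ring.
  by rewrite linearD linearZ /= q0 mulr0 add0r linearD linearZ /= -/y => H; lra.
have [//|y0] := eqVneq y 0.
(* At this x the affine function takes the value -1. *)
have := quad (- (riesz z (h * h) + 1) / (2 * y)).
have -> : 2 * (- (riesz z (h * h) + 1) / (2 * y)) * y = - (riesz z (h * h) + 1).
  by field.
lra.
Qed.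

(** The flat extension theorem.  The family b consists of monomials of degree at
    most s - tc indexing a maximal set of independent rows of M_s among those of
    such degree: equality of the ranks says that these rows span all of them. *)
Lemma flat_tms_atoms (m1 : nat) (g : 'I_m1 -> mpoly p R) (l s : nat)
    (v : tms R p (2 * l)) (tc := uphalf (deg_tuple g)) :
  moment_relax g l v -> (s <= l)%N -> (tc <= s)%N -> (forall i : 'I_p, (0 < tc)%N) ->
  \rank (moment_mx (s - tc) v) = \rank (moment_mx s v) ->
  exists (N : nat) (c : 'I_N -> R) (xi : 'I_N -> 'rV[R]_p),
    [/\ forall k, 0 <= c k, forall k, semialg_set g (xi k)
      & forall m, (mdeg m <= s + s)%N ->
          entry v m = \sum_k c k * meval (xi k 0) (mpolyX R m)].
Proof.
move=> [Mpos gpos] sl tcs tc_gt0; rewrite !rank_moment_mx => rank_eq.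
pose t := (s - tc)%N.
have ts : (t <= s)%N by rewrite leq_subr.
have sigmaP (i : 'I_(nexp p t)) : {j : 'I_(nexp p s) | expo j = expo i}.
  by apply/cid/expo_surj/(leq_trans (expo_mdeg i)).
pose sigma i := sval (sigmaP i).
have sigmaE i : expo (sigma i) = expo i by rewrite /sigma; case: (sigmaP i).
(* Q collects the rows of M_s indexed by monomials of degree at most t. *)
pose H := hankel_mx s v; pose Q := rowsub sigma H.
have QH : (Q <= H)%MS by apply: rowsub_sub.
have HQ : (H <= Q)%MS.
  rewrite -(mxrank_leqif_sup QH) eqn_leq mxrankS//= -rank_eq.
  suff -> : hankel_mx t v = Q *m colsub sigma 1%:M by apply: mxrankM_maxl.
  rewrite mulmx_colsub mulmx1; apply/matrixP => i j.
  by rewrite !mxE !sigmaE.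
pose f := maxrankfun Q.
pose b (k : 'I_(\rank Q)) : mpoly p R := mpolyX R (expo (f k)).
have b_upto k : polys_upto t (b k) by apply/polys_uptoX/expo_mdeg.
have b_upto_l k : polys_upto l (b k).
  by apply: polys_uptoW (b_upto k); apply: leq_trans sl.
have Q_b k j : rowsub f Q k j = riesz v (b k * mpolyX R (expo j)).
  by rewrite !mxE sigmaE.
have upto_l (q : mpoly p R) : polys_upto s q -> polys_upto l q by exact: polys_uptoW.
have riesz_ext D : (forall j : 'I_(nexp p s), riesz v (D * mpolyX R (expo j)) = 0) ->
    forall h, polys_upto s h -> riesz v (D * h) = 0.
  move=> D0; apply: polys_upto_ind.
  - by rewrite mulr0 linear0.
  - by move=> q h IHq IHh; rewrite mulrDr linearD /= IHq IHh addr0.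
  by move=> x m /expo_surj[j <-]; rewrite -scalerAr linearZ /= D0 mulr0.
have comb_b (u : 'rV_(\rank Q)) j :
    riesz v ((\sum_k u 0 k *: b k) * mpolyX R (expo j)) = (u *m rowsub f Q) 0 j.
  rewrite mulr_suml linear_sum mxE; apply: eq_bigr => k _.
  by rewrite -scalerAl linearZ /= Q_b.
have Gpos : posdefmx (\matrix_(k, l') riesz v (b k * b l')).
  split=> [|u u0]; first by apply/matrixP => k k'; rewrite !mxE mulrC.
  pose q := \sum_k u 0 k *: b k.
  have qs : polys_upto s q.
    by apply: polys_upto_sum => k _; apply/polys_uptoZ/(polys_uptoW ts).
  have -> : (u *m (\matrix_(k, l') riesz v (b k * b l')) *m u^T) 0 0 = riesz v (q * q).
    rewrite {2}/q mulr_sumr linear_sum mxE; apply: eq_bigr => k _.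
    rewrite -scalerAr linearZ /= [u^T _ _]mxE mulrC; congr (_ * _).
    rewrite mulr_suml linear_sum mxE; apply: eq_bigr => k' _.
    by rewrite -scalerAl linearZ /= mxE.
  rewrite lt_neqAle (riesz_sqr_ge0 Mpos (upto_l _ qs)) andbT.
  apply: contra_neq u0 => /esym q0; apply: (row_free_inj (maxrowsub_free Q)).
  rewrite mul0mx; apply/rowP => j; rewrite -comb_b mxE -/q.
  apply: (riesz_sqr_eq0 Mpos) q0; first exact: upto_l.
  exact/upto_l/polys_uptoX/expo_mdeg.
have b_spans q : polys_upto s q -> exists w : 'I_(\rank Q) -> R,
    forall h, polys_upto s h -> riesz v (q * h) = \sum_k w k * riesz v (b k * h).
  move=> qs; have /submxP[w wE] : ((vec s q)^T *m H <= rowsub f Q)%MS.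
    by rewrite eq_maxrowsub (submx_trans (submxMl _ _)).
  exists (w 0) => h hs; have : riesz v ((q - \sum_k w 0 k *: b k) * h) = 0.
    apply: riesz_ext hs => j; rewrite mulrBl linearB /= comb_b -wE.
    apply/eqP; rewrite subr_eq0; apply/eqP; rewrite -[in LHS](poly_of_vec qs).
    rewrite mulr_suml linear_sum mxE; apply: eq_bigr => i _.
    by rewrite -scalerAl linearZ /= !mxE.
  rewrite mulrBl linearB /= => /eqP; rewrite subr_eq0 => /eqP ->.
  rewrite mulr_suml linear_sum; apply: eq_bigr => k _.
  by rewrite -scalerAl linearZ.
have t_lt_s (i : 'I_p) : (t < s)%N by rewrite /t; have := tc_gt0 i; lia.
have [c [xi [c_ge0 L_eval supp]]] := flat_functional_atoms ts t_lt_s b_upto Gpos b_spans.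
exists (\rank Q), c, xi; split=> // [k i|m ms]; last first.
  by rewrite -riesz_monomial L_eval//; apply: polys_uptoX.
have gi_tc : (deg (g i) <= tc + tc)%N.
  have : (deg (g i) <= deg_tuple g)%N by apply: leq_bigmax.
  by rewrite /tc; lia.
apply: (supp k (deg (g i))) => [|//|q qt].
- by rewrite /polys_upto /=.
- by rewrite /t; lia.
apply: (riesz_local_ge0 (gpos i)); apply: polys_uptoW qt.
have : (uphalf (deg (g i)) <= tc)%N by apply/uphalf_leq/leq_bigmax.
by rewrite /t; lia.
Qed.


End FlatTms.

(** * Convexity of sets given by conic constraints *)

Section Dot.
Variables (R : realType) (N : nat).
Implicit Types u v : 'cV[R]_N.

Lemma dotE u v : dot u v = (u^T *m v) 0 0.
Proof. by rewrite mxE; apply: eq_bigr => i _; rewrite mxE. Qed.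

Lemma dotC u v : dot u v = dot v u.
Proof. by apply: eq_bigr => i _; rewrite mulrC. Qed.

Lemma dotDr u v v' : dot u (v + v') = dot u v + dot u v'.
Proof. by rewrite !dotE mulmxDr mxE. Qed.

Lemma dot0r u : dot u 0 = 0.
Proof. by rewrite dotE mulmx0 mxE. Qed.

Lemma dotZr u x v : dot u (x *: v) = x * dot u v.
Proof. by rewrite !dotE -scalemxAr mxE. Qed.

Lemma dotDl u u' v : dot (u + u') v = dot u v + dot u' v.
Proof. by rewrite dotC dotDr !(dotC v). Qed.

Lemma dotZl x u v : dot (x *: u) v = x * dot u v.
Proof. by rewrite dotC dotZr (dotC v). Qed.

Lemma dotBl u u' v : dot (u - u') v = dot u v - dot u' v.
Proof. by rewrite -scaleN1r dotDl dotZl mulN1r. Qed.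

Lemma dot_sumr (I : Type) (r : seq I) u (F : I -> 'cV[R]_N) :
  dot u (\sum_(i <- r) F i) = \sum_(i <- r) dot u (F i).
Proof. by rewrite dotE mulmx_sumr summxE; apply: eq_bigr => i _; rewrite dotE. Qed.

Lemma dot_ge0 u : 0 <= dot u u.
Proof. by apply: sumr_ge0 => i _; rewrite -expr2 sqr_ge0. Qed.

Lemma dot_eq0 u : dot u u = 0 -> u = 0.
Proof.
move=> /eqP; rewrite psumr_eq0 => [/allP u0|i _]; last by rewrite -expr2 sqr_ge0.
apply/colP => i; have /= := u0 i (mem_index_enum _).
by rewrite mulf_eq0 orbb mxE => /eqP.
Qed.

Lemma dot_cauchy_schwarz u v :
  dot u v <= Num.sqrt (dot u u) * Num.sqrt (dot v v).
Proof.
set x := Num.sqrt (dot u u); set y := Num.sqrt (dot v v).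
have [x2 y2] : x ^+ 2 = dot u u /\ y ^+ 2 = dot v v by rewrite !sqr_sqrtr ?dot_ge0.
have [x0|x_neq0] := eqVneq x 0.
  move: x2; rewrite x0 expr0n mul0r /= => /esym/dot_eq0 ->.
  by rewrite dotC dot0r.
have [y0|y_neq0] := eqVneq y 0.
  move: y2; rewrite y0 expr0n mulr0 /= => /esym/dot_eq0 ->.
  by rewrite dot0r.
have x_gt0 : 0 < x by rewrite lt_neqAle eq_sym x_neq0 sqrtr_ge0.
have y_gt0 : 0 < y by rewrite lt_neqAle eq_sym y_neq0 sqrtr_ge0.
have := dot_ge0 (y *: u - x *: v).
rewrite dotBl !(dotC _ (_ - _)) !dotBl !dotZl !(dotC _ (_ *: _)) !dotZl -x2 -y2 (dotC v u).
have -> : y * (y * x ^+ 2) - x * (y * dot u v) - (y * (x * dot u v) - x * (x * y ^+ 2)) =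
  (x * y *+ 2) * (x * y - dot u v) by ring.
by rewrite pmulr_rge0 ?subr_ge0// mulrn_wgt0// mulr_gt0.
Qed.

End Dot.

Section ConicConstraints.
Variables (R : realType) (N : nat).

(** For a second-order constraint, with z_i = F u_i + h, tau_i = a^T u_i + b and
    z, tau their averages, |z|^2 = sum_i t_i <z, z_i> <= |z| tau. *)
Lemma satisfies_convex (c : conic_constraint R N) (s : nat) (t : 'I_s -> R)
    (u : 'I_s -> 'cV[R]_N) :
  (forall i, 0 <= t i) -> \sum_i t i = 1 -> (forall i, satisfies c (u i)) ->
  satisfies c (\sum_i t i *: u i).
Proof.
move=> t_ge0 t_sum1.
have avg (V : lmodType R) (v : V) : v = \sum_i t i *: v by rewrite -scaler_suml t_sum1 scale1r.
have avg_dot a b : dot a (\sum_i t i *: u i) + b = \sum_i t i * (dot a (u i) + b).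
  rewrite dot_sumr; under [in RHS]eq_bigr do rewrite mulrDr.
  by rewrite big_split /= -mulr_suml t_sum1 mul1r; congr (_ + _); apply: eq_bigr => i _; rewrite dotZr.
case: c => [a b|q F h a b|q F0 F] /= uc.
- by rewrite avg_dot sumr_ge0// => i _; rewrite mulr_ge0.
- rewrite avg_dot; pose z i := F *m u i + h.
  have -> : F *m (\sum_i t i *: u i) + h = \sum_i t i *: z i.
    rewrite mulmx_sumr {1}[h]avg -big_split; apply: eq_bigr => i _.
    by rewrite /= -scalemxAr -scalerDr.
  set y := \sum_i _; set r := Num.sqrt _; set x := \sum_i _.
  have r2 : r ^+ 2 = dot y y by rewrite sqr_sqrtr ?dot_ge0.
  have x_ge0 : 0 <= x.
    by apply: sumr_ge0 => i _; rewrite mulr_ge0// (le_trans _ (uc i))// sqrtr_ge0.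
  have rx : r * r <= r * x.
    rewrite -expr2 r2 {2}/y dot_sumr mulr_sumr; apply: ler_sum => i _.
    rewrite dotZr mulrCA ler_wpM2l// (le_trans (dot_cauchy_schwarz _ _))//.
    by rewrite ler_wpM2l ?sqrtr_ge0// uc.
  have [->//|r_neq0] := eqVneq r 0.
  by move: rx; rewrite ler_pM2l// lt_neqAle eq_sym r_neq0 sqrtr_ge0.
- pose G i := F0 + \sum_j u i j 0 *: F j.
  have -> : F0 + \sum_j (\sum_i t i *: u i) j 0 *: F j = \sum_i t i *: G i.
    rewrite {1}[F0]avg /G; under [in RHS]eq_bigr do rewrite scalerDr scaler_sumr.
    rewrite big_split /= exchange_big /=; congr (_ + _); apply: eq_bigr => j _.
    by rewrite summxE scaler_suml; apply: eq_bigr => i _; rewrite mxE scalerA.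
  split=> [|v].
    by rewrite linear_sum; apply: eq_bigr => i _ /=; rewrite linearZ /= (uc i).1.
  rewrite mulmx_suml dot_sumr sumr_ge0// => i _.
  by rewrite -scalemxAl dotZr mulr_ge0// (uc i).2.
Qed.

Lemma conic_constraints_convex (C : set 'cV[R]_N) (s : nat) (t : 'I_s -> R)
    (u : 'I_s -> 'cV[R]_N) :
  given_by_conic_constraints C ->
  (forall i, 0 <= t i) -> \sum_i t i = 1 -> (forall i, C (u i)) ->
  C (\sum_i t i *: u i).
Proof.
by move=> [k [c ->]] t_ge0 t1 uC j; apply: satisfies_convex => // i; apply: uC.
Qed.

End ConicConstraints.

Section Cones.
Variables (R : realType) (N : nat) (C : set 'cV[R]_N).

Lemma cone0 : cone C 0.
Proof. by exists 0%N, (fun=> 0), (fun=> 0); split=> [[]//|]; rewrite big_ord0. Qed.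

Lemma coneZ x y : 0 <= x -> cone C y -> cone C (x *: y).
Proof.
move=> x0 [s [c [u [cu ->]]]]; exists s, (fun i => x * c i), u; split.
  by move=> i; case: (cu i) => ? ?; split=> //; apply: mulr_ge0.
by rewrite scaler_sumr; apply: eq_bigr => i _; rewrite scalerA.
Qed.

Lemma coneD y z : cone C y -> cone C z -> cone C (y + z).
Proof.
move=> [s [c [u [cu ->]]]] [s' [c' [u' [cu' ->]]]].
exists (s + s')%N, (fun i => match fintype.split i with inl j => c j | inr j => c' j end),
  (fun i => match fintype.split i with inl j => u j | inr j => u' j end); split.
  by move=> i; case: (fintype.split i).
rewrite big_split_ord /=; congr (_ + _); apply: eq_bigr => i _.
  by rewrite (unsplitK (inl i : 'I_s + 'I_s')).
by rewrite (unsplitK (inr i : 'I_s + 'I_s')).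
Qed.

Lemma cone_sum (I : Type) (r : seq I) (F : I -> 'cV[R]_N) :
  (forall i, cone C (F i)) -> cone C (\sum_(i <- r) F i).
Proof.
move=> CF; elim/big_ind: _ => //; last exact: coneD.
exact: cone0.
Qed.

End Cones.

(** * Flat extensions and the moment cone *)

Lemma row_space_not_compact (R : realType) (p : nat) (i : 'I_p) :
  ~ compact [set: 'rV[R]_p].
Proof.
move=> cT; pose f (x : 'rV[R]_p) : R := x 0 i.
have /compact_bounded [M [_ Mb]] : compact (f @` setT).
  apply: continuous_compact => //; apply: continuous_subspaceT => x.
  exact: coord_continuous.
have /= := Mb (M + 1) (ltr_pwDr ltr01 (lexx _)) (`|M| + 2).
have -> : `| `|M| + 2 | = `|M| + 2 :> R by rewrite ger0_norm// addr_ge0.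
have := ler_norm M => H1 H2.
have : `|M| + 2 <= M + 1 by apply: H2; exists (const_mx (`|M| + 2)); rewrite // /f mxE.
lra.
Qed.

(** A negative constant among the g_i makes both L(q^2) and -L(q^2) nonnegative,
    so that the Riesz functional vanishes. *)
Lemma negative_constraint_tms0 (R : realType) (p m1 : nat)
    (g : 'I_m1 -> mpoly p R) (l : nat) (v : tms R p (2 * l)) (i : 'I_m1) (x : R) :
  moment_relax g l v -> g i = mpolyC p x -> x < 0 ->
  forall m, (mdeg m <= 2 * l)%N -> entry v m = 0.
Proof.
move=> [Mpos /(_ i) gpos] gi x0 m ml.
have /mdeg_split[m' [m'' [-> m'l m''l]]] : (mdeg m <= l + l)%N by lia.
rewrite -riesz_monomial mpolyXD.
have [ul ul'] := (polys_uptoX R m'l, polys_uptoX R m''l).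
apply: (riesz_sqr_eq0 Mpos ul ul').
apply/eqP; rewrite eq_le (riesz_sqr_ge0 Mpos ul) andbT.
have := riesz_local_ge0 gpos (q := mpolyX R m').
have -> : deg (g i) = 0%N by rewrite gi /deg msizeC; case: (x != 0).
rewrite subn0 gi -mulrA mul_mpolyC linearZ /= => /(_ ul).
by rewrite nmulr_rge0.
Qed.

(** If every g_i is constant then S is empty or the whole space.  The former
    forces v = 0, and the latter contradicts compactness unless there is no
    variable, in which case the general argument applies. *)
Lemma flat_extension_moment_cone (R : realType) (p m1 d l : nat)
    (g : 'I_m1 -> mpoly p R) (v : tms R p (2 * l)) :
  compact (semialg_set g) -> moment_relax g l v -> flat d g v ->
  moment_cone d (semialg_set g) (trunc d v).
Proof.
move=> cS vg [s [/[!geq_max]/andP[t0s tcs] sl flat_s]].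
have expo_2s (i : 'I_(nexp p d)) : (mdeg (expo i) <= s + s)%N.
  by have := expo_mdeg i; lia.
have [tc_gt0|tc_le0] := pselect (forall i : 'I_p, 0 < uphalf (deg_tuple g))%N.
  have [N [c [xi [c_ge0 xiS vE]]]] := flat_tms_atoms vg sl tcs tc_gt0 flat_s.
  exists N, c, (fun k => mono_vec d (xi k)); split.
    by move=> k; split=> //; exists (xi k).
  apply/colP => i; rewrite mxE vE// summxE; apply: eq_bigr => k _.
  by rewrite !mxE.
have [i0 tc0] : exists i0 : 'I_p, (uphalf (deg_tuple g) = 0)%N.
  apply: contrapT => H; apply: tc_le0 => i; rewrite lt0n; apply/eqP => tc0.
  by apply: H; exists i.
have g_const i : g i = mpolyC p (mcoeff mnm0 (g i)).
  apply: msize1_polyC; have : (deg (g i) <= deg_tuple g)%N by apply: leq_bigmax.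
  by rewrite /deg; move: (msize (g i)) tc0 => k; lia.
have [[i gi_lt0]|g_ge0] := pselect (exists i, mcoeff mnm0 (g i) < 0).
  have -> : trunc d v = 0.
    apply/colP => j; rewrite !mxE; apply: (negative_constraint_tms0 vg (g_const i)) => //.
    by apply: (leq_trans (expo_2s j)); lia.
  exact: cone0.
exfalso; apply: (@row_space_not_compact R _ i0).
suff <- : semialg_set g = setT by [].
apply/seteqP; split=> // x _ i; rewrite g_const mevalC leNgt; apply/negP => gi.
by apply: g_ge0; exists i.
Qed.

(** * States reached by the algorithm *)

Section Termination.
Variables (R : realType) (n p m m1 d : nat).
Variables (g : 'I_m1 -> mpoly p R) (B : set (tms R p d)) (a : 'I_m.+1 -> R).
Variables (A : 'I_m.+1 -> 'M[R]_(nexp p d, n)) (c : 'I_m.+1 -> tms R p d).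
Variable rho : mpoly p R.

(** An invariant of Steps 2 and 3: Step 1 leaves optimizers
    of both relaxations, and every computed v_j extends the current y_j. *)
Definition sound_status (k : nat) (P : primal_point R n p d)
    (D : dual_point R n p m d k) (st : 'I_m.+1 -> ext_status R p) : Prop :=
  [/\ primal_optimizer g B a A c k P, dual_optimizer g B a A c D
    & forall j, dp_y D j != 0 ->
        if st j is Computed l v then extension_feasible g (dp_y D j) v else True].

Definition sound_state (s : alg_state R n p m d) : Prop :=
  match s with
  | AtStep1 _ _ => True
  | AtStep2 k P D st => sound_status P D st
  | AtStep3 k P D st => sound_status P D st
  | Terminated P gamma0 gamma y =>
      exists k (D : dual_point R n p m d k),
        [/\ primal_optimizer g B a A c k P, dual_optimizer g B a A c D,
            [/\ gamma0 = dp_gamma0 D, gamma = dp_gamma D & y = dp_y D]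
          & forall j, y j != 0 -> exists l (v : tms R p (2 * l)),
              extension_feasible g (y j) v /\ flat d g v]
  end.

Lemma alg_step_sound s s' :
  alg_step g B a A c rho s s' -> sound_state s -> sound_state s'.
Proof.
case=> //=.
- move=> k P D st st' solve keep [optP optD st_ok]; split=> // j yj.
  case stj: (st j) => [l|l v]; first by have [v [fv _] ->] := solve j yj l stj.
  by rewrite keep; [exact: st_ok|right; exists l, v].
- move=> k P D st j l v yj stj _ [optP optD st_ok]; split=> // i yi.
  by case: eqP => // _; apply: st_ok.
- move=> k P D st mu st_flat _ _ _ [optP optD st_ok]; exists k, D; split=> // j yj.
  have [l [v [stj fv]]] := st_flat j yj.
  by exists l, v; split=> //; have := st_ok j yj; rewrite stj.
Qed.

Lemma terminates_sound P gamma0 gamma y :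
  terminates_with g B a A c rho P gamma0 gamma y ->
  sound_state (Terminated P gamma0 gamma y).
Proof.
move=> run; have : sound_state (alg_init n m d g) by [].
move: run; rewrite /terminates_with => run.
elim: run => // s1 s2 s3 step _ IH /(alg_step_sound step); exact: IH.
Qed.

End Termination.

(** * Integrals of functions bounded on the support of a measure *)

(** Extending the family by the zero measure makes it a sequence, whose partial
    sums are known to be measures. *)
Section MeasureSum.
Context {disp : measure_display} {T : measurableType disp} {R : realType}.
Variables (N : nat) (mu : 'I_N -> {finite_measure set T -> \bar R}).

Definition nat_family (k : nat) : {measure set T -> \bar R} :=
  if insub k is Some i then mu i else mzero.

Definition measure_sum : set T -> \bar R := msum nat_family N.

HB.instance Definition _ := measure_function.Measure.copy measure_sum (msum nat_family N).

Lemma nat_familyE (i : 'I_N) : nat_family i = mu i :> {measure set T -> \bar R}.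
Proof. by rewrite /nat_family valK. Qed.

Lemma measure_sumE (A : set T) : measure_sum A = (\sum_(i < N) mu i A)%E.
Proof. by rewrite /measure_sum /msum; apply: eq_bigr => i _; rewrite nat_familyE. Qed.

Let measure_sum_fin : fin_num_fun measure_sum.
Proof.
move=> A mA; rewrite measure_sumE sum_fin_num; apply/allP => x /mapP[i _ ->].
exact: fin_num_measure.
Qed.

HB.instance Definition _ := Measure_isFinite.Build _ _ _ measure_sum measure_sum_fin.

End MeasureSum.

Section BoundedFunctions.
Context {disp : measure_display} {T : measurableType disp} {R : realType}.
Variable S : set T.

(** The functions that are integrated below: against a finite measure carried by
    S they are integrable, and only their values on S matter. *)
Definition bounded_meas (f : T -> R) : Prop :=
  measurable_fun setT f /\ exists M, forall x, S x -> `|f x| <= M.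

Lemma bounded_meas_cst r : bounded_meas (cst r).
Proof. by split=> //; exists `|r|. Qed.

Lemma bounded_measD f h :
  bounded_meas f -> bounded_meas h -> bounded_meas (fun x => f x + h x).
Proof.
move=> [mf [M fM]] [mh [M' hM]]; split; first exact: measurable_funD.
exists (M + M') => x Sx; apply: le_trans (ler_normD _ _) _.
by rewrite lerD ?fM ?hM.
Qed.

Lemma bounded_measZ r f : bounded_meas f -> bounded_meas (fun x => r * f x).
Proof.
move=> [mf [M fM]]; split; first exact: measurable_funM.
by exists (`|r| * M) => x Sx; rewrite normrM ler_wpM2l ?fM.
Qed.

Lemma bounded_measB f h :
  bounded_meas f -> bounded_meas h -> bounded_meas (fun x => f x - h x).
Proof.
move=> bf /(bounded_measZ (-1)) bh; have := bounded_measD bf bh.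
by under eq_fun do rewrite mulN1r.
Qed.

Lemma bounded_meas_max f h :
  bounded_meas f -> bounded_meas h -> bounded_meas (fun x => Num.max (f x) (h x)).
Proof.
move=> [mf [M fM]] [mh [M' hM]]; split; first exact: measurable_maxr.
exists (Num.max M M') => x Sx; rewrite le_max.
by rewrite /Num.max; case: ifP => _; rewrite ?fM ?hM ?orbT.
Qed.

Hypothesis mS : measurable S.

Section OneMeasure.
Variable mu : {finite_measure set T -> \bar R}.
Hypothesis muS : mu (~` S) = 0%E.

Lemma bounded_meas_integrable f : bounded_meas f -> mu.-integrable setT (EFin \o f).
Proof.
move=> [mf [M fM]].
have mEf : measurable_fun setT (EFin \o f) by apply/measurable_EFinP.
apply/(negligible_integrable (measurableC mS) measurableT mEf muS).
rewrite setTD setCK; apply: measurable_bounded_integrable => //.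
- by rewrite ltey_eq fin_num_measure.
- exact: measurable_funTS.
- exists M; split; first exact: num_real.
  by move=> x Mx y Sy /=; apply: le_trans (fM y Sy) (ltW Mx).
Qed.

Lemma eq_on_Rintegral f h : bounded_meas f -> bounded_meas h ->
  (forall x, S x -> f x = h x) -> Rintegral mu setT f = Rintegral mu setT h.
Proof.
move=> [mf _] [mh _] fh; congr fine; apply: ae_eq_integral => //.
- exact/measurable_EFinP.
- exact/measurable_EFinP.
exists (~` S); split=> //; first exact: measurableC.
by move=> x /= nfh Sx; apply: nfh => _; rewrite fh.
Qed.

Lemma ge0_on_Rintegral f : bounded_meas f ->
  (forall x, S x -> 0 <= f x) -> 0 <= Rintegral mu setT f.
Proof.
move=> bf f0; have bf' := bounded_meas_max bf (bounded_meas_cst 0).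
rewrite (eq_on_Rintegral bf bf') => [|x Sx]; last by rewrite max_l ?f0.
by apply: Rintegral_ge0 => x _; rewrite le_max lexx orbT.
Qed.

Lemma Rintegral_bounded_measD f h : bounded_meas f -> bounded_meas h ->
  Rintegral mu setT (fun x => f x + h x) = Rintegral mu setT f + Rintegral mu setT h.
Proof. by move=> bf bh; rewrite RintegralD//; apply: bounded_meas_integrable. Qed.

Lemma Rintegral_bounded_measB f h : bounded_meas f -> bounded_meas h ->
  Rintegral mu setT (fun x => f x - h x) = Rintegral mu setT f - Rintegral mu setT h.
Proof. by move=> bf bh; rewrite RintegralB//; apply: bounded_meas_integrable. Qed.

Lemma Rintegral_bounded_measZ r f : bounded_meas f ->
  Rintegral mu setT (fun x => r * f x) = r * Rintegral mu setT f.
Proof. by move=> bf; rewrite RintegralZl//; apply: bounded_meas_integrable. Qed.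

Lemma le_on_Rintegral f h : bounded_meas f -> bounded_meas h ->
  (forall x, S x -> f x <= h x) -> Rintegral mu setT f <= Rintegral mu setT h.
Proof.
move=> bf bh fh; rewrite -subr_ge0 -Rintegral_bounded_measB//.
apply: ge0_on_Rintegral; first exact: bounded_measB.
by move=> x Sx; rewrite subr_ge0 fh.
Qed.

End OneMeasure.

(** Additivity of the integral in the measure is known for nonnegative functions;
    the general case follows from f = max(f, 0) - max(-f, 0). *)
Lemma Rintegral_measure_sum (N : nat) (mu : 'I_N -> {finite_measure set T -> \bar R})
    (nu : {finite_measure set T -> \bar R}) (f : T -> R) :
  (forall i, mu i (~` S) = 0%E) ->
  (forall A, measurable A -> nu A = (\sum_(i < N) mu i A)%E) ->
  bounded_meas f ->
  Rintegral nu setT f = \sum_(i < N) Rintegral (mu i) setT f.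
Proof.
move=> muS nuE.
have nuS : nu (~` S) = 0%E.
  by rewrite nuE; [rewrite big1|exact: measurableC].
have pos h : bounded_meas h -> (forall x, 0 <= h x) ->
    Rintegral nu setT h = \sum_(i < N) Rintegral (mu i) setT h.
  move=> bh h0; have [mh _] := bh; rewrite /Rintegral.
  rewrite (eq_measure_integral (msum (nat_family mu) N)); last first.
    by move=> A mA _; apply: etrans (nuE A mA) _; rewrite -measure_sumE.
  rewrite ge0_integral_measure_sum//.
  - rewrite sum_fine => [|i _].
      by congr fine; apply: eq_bigr => i _; rewrite nat_familyE.
    exact/integrable_fin_num/bounded_meas_integrable.
  - by move=> x _; rewrite lee_fin.
  - exact/measurable_EFinP.
move=> bf; pose fp x := Num.max (f x) 0; pose fn x := Num.max (-1 * f x) 0.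
have bfp : bounded_meas fp by apply/bounded_meas_max/bounded_meas_cst.
have bfn : bounded_meas fn.
  by apply: bounded_meas_max; [exact: bounded_measZ|exact: bounded_meas_cst].
have fE : f = (fun x => fp x - fn x).
  apply/funext => x; rewrite /fp /fn mulN1r.
  by case: (lerP 0 (f x)) => f0; case: (lerP 0 (- f x)) => f0'; lra.
rewrite fE Rintegral_bounded_measB// !pos//; last 2 first.
- by move=> x; rewrite le_max lexx orbT.
- by move=> x; rewrite le_max lexx orbT.
by rewrite -sumrB; apply: eq_bigr => i _; rewrite Rintegral_bounded_measB.
Qed.

End BoundedFunctions.

Section Atomic.
Context {disp : measure_display} {T : measurableType disp} {R : realType}.

Definition point_mass (c : {nonneg R}) (u : T) : {finite_measure set T -> \bar R} :=
  mscale c (@dirac _ T u R).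

Lemma point_mass_compl c (u : T) (E : set T) : E u -> point_mass c u (~` E) = 0%E.
Proof.
by move=> Eu; rewrite /point_mass /= /mscale /= diracE memNset ?mule0//=; apply.
Qed.

(** The point mass at u is carried by the level set of f through u, on which f is
    constant. *)
Lemma Rintegral_point_mass c (u : T) (f : T -> R) : measurable_fun setT f ->
  Rintegral (point_mass c u) setT f = c%:num * f u.
Proof.
move=> mf; pose E := f @^-1` [set f u].
have mE : measurable E by rewrite -[E]setTI; apply: mf.
have bf : bounded_meas E f.
  by split=> //; exists `|f u| => x; rewrite /E /= => ->.
rewrite (eq_on_Rintegral mE (point_mass_compl c _) bf (bounded_meas_cst E (f u)))//.
by rewrite Rintegral_cst// /point_mass /= /mscale /= indicT mulr1 mulrC.
Qed.

End Atomic.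

(** * Moments of measures on a compact set *)

Section PolynomialFunctions.
Variables (R : realType) (p : nat).

Lemma continuous_meval (q : mpoly p R) :
  continuous (fun xi : 'rV[R]_p => meval (xi 0) q).
Proof.
have cont_big (op : R -> R -> R) (idx : R) (I : Type) (r : seq I)
    (F : I -> 'rV[R]_p -> R) :
    (forall f h : 'rV[R]_p -> R, continuous f -> continuous h ->
       continuous (fun x => op (f x) (h x))) ->
    (forall i, continuous (F i)) ->
    continuous (fun x => \big[op/idx]_(i <- r) F i x).
  move=> cop cF; elim: r => [|i r IHr].
    by under eq_fun do rewrite big_nil; apply: cst_continuous.
  by under eq_fun do rewrite big_cons; apply: cop.
under eq_fun do rewrite mevalE.
apply: (cont_big) => [f h cf ch x|m]; first exact: continuousD (cf x) (ch x).
move=> x; apply: continuousM; first exact: cst_continuous.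
move: x; apply: cont_big => [f h cf ch x|i x].
  exact: continuousM (cf x) (ch x).
apply: (@continuous_comp _ _ _ (fun x : 'rV[R]_p => x 0 i) (fun y : R => y ^+ m i)).
  exact: coord_continuous.
exact: exprn_continuous.
Qed.

Lemma continuous_measurable_Rp (f : 'rV[R]_p -> R) :
  continuous f -> measurable_fun setT (f : Rp R p -> R).
Proof.
move=> cf; apply: (measurability _ (RGenOInfty.measurableE R)) => //.
move=> _ [_ [x ->] <-]; rewrite setTI; apply: sub_sigma_algebra.
by apply: open_comp => // y _; apply: cf.
Qed.

Lemma measurable_semialg (m1 : nat) (g : 'I_m1 -> mpoly p R) :
  measurable (semialg_set g : set (Rp R p)).
Proof.
have -> : (semialg_set g : set (Rp R p)) =
    \bigcap_(i in [set: 'I_m1]) ((fun xi : 'rV[R]_p => meval (xi 0) (g i)) @^-1` `[0, +oo[).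
  apply/seteqP; split=> x /= Sx i; first by move=> _ /=; rewrite in_itv /= andbT.
  by have := Sx i Logic.I; rewrite /= in_itv /= andbT.
apply: fin_bigcap_measurable => // i _; rewrite -[X in measurable X]setTI.
have mg := continuous_measurable_Rp (@continuous_meval (g i)).
by apply: mg => //; exact: measurable_itv.
Qed.

Lemma bounded_meas_continuous (S : set 'rV[R]_p) (f : 'rV[R]_p -> R) :
  compact S -> continuous f -> bounded_meas (S : set (Rp R p)) f.
Proof.
move=> cS cf; split; first exact: continuous_measurable_Rp.
have /compact_bounded [M [_ Mb]] : compact (f @` S).
  by apply: continuous_compact => //; apply: continuous_subspaceT.
exists (M + 1) => x Sx.
by apply: (Mb (M + 1) (ltr_pwDr ltr01 (lexx _))); exists x.
Qed.

End PolynomialFunctions.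

Section MomentsOfMeasures.
Variables (R : realType) (p d : nat) (S : set 'rV[R]_p).
Hypothesis S_compact : compact S.
Hypothesis S_meas : measurable (S : set (Rp R p)).

Lemma dot_mono_vec (w : tms R p d) (xi : 'rV[R]_p) :
  dot w (mono_vec d xi) = meval (xi 0) (poly_of w).
Proof.
rewrite /poly_of raddf_sum; apply: eq_bigr => i _.
by rewrite /= mevalZ mxE.
Qed.

Lemma bounded_meas_dot (w : tms R p d) :
  bounded_meas (S : set (Rp R p)) (fun xi => dot w (mono_vec d xi)).
Proof.
under eq_fun do rewrite dot_mono_vec.
exact/bounded_meas_continuous/continuous_meval.
Qed.

Lemma Rintegral_dot (mu : {finite_measure set (Rp R p) -> \bar R}) (w : tms R p d) :
  supported S mu ->
  Rintegral mu setT (fun xi => dot w (mono_vec d xi)) = dot w (moments d mu).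
Proof.
move=> muS; rewrite /dot.
have bX i : bounded_meas (S : set (Rp R p)) (fun xi => mono_vec d xi i 0).
  under eq_fun do rewrite mxE.
  exact/bounded_meas_continuous/continuous_meval.
have step (s : seq 'I_(nexp p d)) :
    bounded_meas (S : set (Rp R p)) (fun xi => \sum_(i <- s) w i 0 * mono_vec d xi i 0)
    /\ Rintegral mu setT (fun xi => \sum_(i <- s) w i 0 * mono_vec d xi i 0)
      = \sum_(i <- s) w i 0 * moments d mu i 0.
  elim: s => [|i s [bs IHs]].
    under eq_fun do rewrite big_nil; split; first exact: bounded_meas_cst.
    by rewrite big_nil Rintegral_cst// mul0r.
  have bi : bounded_meas (S : set (Rp R p)) (fun xi => w i 0 * mono_vec d xi i 0).
    exact: bounded_measZ.
  under eq_fun do rewrite big_cons; split; first exact: bounded_measD.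
  rewrite (Rintegral_bounded_measD S_meas)// IHs (Rintegral_bounded_measZ S_meas)//.
  by rewrite big_cons mxE.
by have [_] := step (index_enum _).
Qed.

Lemma dot_e1_mono_vec (xi : 'rV[R]_p) : dot (e1 d) (mono_vec d xi) = 1.
Proof.
have [i0 i0E] : exists i : 'I_(nexp p d), expo i = mnm0.
  by apply: expo_surj; rewrite mdeg0.
rewrite /dot (bigD1 i0)//= !mxE i0E eqxx mul1r mpolyX0 meval1 big1 ?addr0// => i ii0.
rewrite !mxE; case: eqP => [iE|_]; last by rewrite mul0r.
by case/eqP: ii0; apply/enum_val_inj/val_inj; rewrite -[LHS]/(expo i) iE -i0E.
Qed.

Lemma dot_e1_moments (mu : {finite_measure set (Rp R p) -> \bar R}) :
  supported S mu -> dot (e1 d) (moments d mu) = fine (mu setT).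
Proof.
move=> muS; rewrite -Rintegral_dot//; under eq_fun do rewrite dot_e1_mono_vec.
by rewrite Rintegral_cst// mul1r.
Qed.

(** Conic combinations of vectors [xi]_d are moments of finitely atomic measures. *)
Lemma moment_cone_measure (y : tms R p d) : moment_cone d S y ->
  exists2 mu : {finite_measure set (Rp R p) -> \bar R},
    supported S mu & moments d mu = y.
Proof.
move=> [N [c [u [cu ->]]]].
have /choice[xi xiP] : forall i : 'I_N, exists x : 'rV[R]_p, S x /\ mono_vec d x = u i.
  move=> i; have [_ [xi Sxi xiE]] := cu i.
  by exists xi.
have c_ge0 i : 0 <= c i by case: (cu i).
pose m (i : 'I_N) := point_mass (NngNum (c_ge0 i)) (xi i : Rp R p).
have mS i : m i (~` (S : set (Rp R p))) = 0%E.
  by apply: point_mass_compl; case: (xiP i).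
exists (measure_sum m).
  by apply: etrans (measure_sumE _ _) _; rewrite big1.
apply/colP => i; rewrite mxE.
have bX : bounded_meas (S : set (Rp R p)) (fun xi => mono_vec d xi i 0).
  under eq_fun do rewrite mxE.
  exact/bounded_meas_continuous/continuous_meval.
rewrite (Rintegral_measure_sum S_meas mS (nu := measure_sum m) _ bX); last first.
  by move=> A mA; apply: measure_sumE.
rewrite summxE; apply: eq_bigr => k _.
by rewrite Rintegral_point_mass; [rewrite -(xiP k).2 [RHS]mxE|exact: bX.1].
Qed.

End MomentsOfMeasures.

Section Loss.
Variables (R : realType) (m : nat) (a b : 'I_m.+1 -> R).

Lemma loss_ge Z j : a j * Z + b j <= loss a b Z.
Proof. by rewrite /loss (bigD1 j)//= le_max lexx. Qed.

Lemma loss_attained Z : exists j, loss a b Z = a j * Z + b j.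
Proof.
rewrite /loss; elim/big_ind: _ => [|x y [i ->] [j ->]|j _]; [by exists ord0| |by exists j].
by rewrite /Num.max; case: ifP => _; [exists j|exists i].
Qed.

End Loss.

(** * The robust constraint and the expected loss *)

Section Reformulation.
Variables (R : realType) (n p m d : nat).
Variables (r : 'I_n -> mpoly p R) (lambda : R) (a b : 'I_m.+1 -> R).
Variables (A : 'I_m.+1 -> 'M[R]_(nexp p d, n)) (c : 'I_m.+1 -> tms R p d).
Hypothesis fpieceE : forall j t x xi,
  fpiece lambda a b r j t x xi = dot (fcoef a A c j t x) (mono_vec d xi).
Variable S : set 'rV[R]_p.
Hypothesis S_compact : compact S.
Hypothesis S_meas : measurable (S : set (Rp R p)).

Let S' : set (Rp R p) := S.

Lemma bounded_meas_fpiece j t x :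
  bounded_meas S' (fun xi => fpiece lambda a b r j t x xi).
Proof. by under eq_fun do rewrite fpieceE; exact: bounded_meas_dot. Qed.

Lemma fpiece_loss_le j t x xi :
  lambda - loss a b (- returns r x xi - t) <= fpiece lambda a b r j t x xi.
Proof. by rewrite /fpiece lerB// loss_ge. Qed.

Lemma bounded_meas_loss t x :
  bounded_meas S' (fun xi => lambda - loss a b (- returns r x xi - t)).
Proof.
apply: bounded_measB; first exact: bounded_meas_cst.
have piece j : bounded_meas S' (fun xi => a j * (- returns r x xi - t) + b j).
  have -> : (fun xi : Rp R p => a j * (- returns r x xi - t) + b j) =
      (fun xi => lambda - fpiece lambda a b r j t x xi).
    by apply/funext => xi; rewrite /fpiece subKr.
  by apply: bounded_measB; [exact: bounded_meas_cst|exact: bounded_meas_fpiece].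
rewrite /loss; elim: (index_enum _) => [|j s IHs].
  by under eq_fun do rewrite big_nil; exact: piece.
under eq_fun do rewrite big_cons; exact: bounded_meas_max.
Qed.

Section FixedDecision.
Variables (t : R) (x : 'cV[R]_n).

Let slack xi : R := lambda - loss a b (- returns r x xi - t).
Let slackP : bounded_meas S' slack := bounded_meas_loss t x.

Lemma expectation_loss_le (nu : probability (Rp R p) R) : supported S nu ->
  ('E_nu[fun xi : Rp R p => loss a b (- returns r x xi - t)] <= lambda%:E)%E
    = (0 <= Rintegral nu setT slack).
Proof.
move=> nuS; have bl : bounded_meas S' (fun xi => loss a b (- returns r x xi - t)).
  have -> : (fun xi : Rp R p => loss a b (- returns r x xi - t)) =
      (fun xi => lambda - slack xi).
    by apply/funext => xi; rewrite /slack subKr.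
  by apply: bounded_measB; first exact: bounded_meas_cst.
rewrite unlock -[X in (X <= _)%E]fineK; last first.
  exact/integrable_fin_num/(bounded_meas_integrable S_meas nuS).
rewrite lee_fin -[X in X <= _]/(Rintegral nu setT _).
rewrite (Rintegral_bounded_measB S_meas nuS (bounded_meas_cst S' lambda) bl).
rewrite Rintegral_cst// [fine _](_ : _ = 1) ?mulr1 ?subr_ge0//.
exact: (congr1 fine (probability_setT nu)).
Qed.

(** Any decomposition of nu does at least as well as the loss, since every piece
    is below the maximum. *)
Lemma slack_le_split (mu : 'I_m.+1 -> {finite_measure set (Rp R p) -> \bar R})
    (nu : probability (Rp R p) R) :
  (forall j, supported S (mu j)) ->
  (forall E, measurable E -> nu E = (\sum_(j < m.+1) mu j E)%E) ->
  Rintegral nu setT slack <=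
    \sum_(j < m.+1) Rintegral (mu j) setT (fun xi => fpiece lambda a b r j t x xi).
Proof.
move=> muS nuE; rewrite (Rintegral_measure_sum S_meas muS nuE slackP).
apply: ler_sum => j _.
apply: (le_on_Rintegral S_meas (muS j) slackP (bounded_meas_fpiece j t x)).
by move=> xi _; exact: fpiece_loss_le.
Qed.

(** Equality for the restrictions of nu to the sets E j where j is the least
    index whose piece attains the maximum. *)
Lemma slack_attained_split (nu : probability (Rp R p) R) : supported S nu ->
  exists mu : 'I_m.+1 -> {finite_measure set (Rp R p) -> \bar R},
    [/\ forall j, supported S (mu j),
        forall E, measurable E -> nu E = (\sum_(j < m.+1) mu j E)%E
      & \sum_(j < m.+1) Rintegral (mu j) setT (fun xi => fpiece lambda a b r j t x xi)
          = Rintegral nu setT slack].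
Proof.
move=> nuS.
pose gap j xi := fpiece lambda a b r j t x xi - slack xi.
pose D j : set (Rp R p) := gap j @^-1` [set 0].
have mD j : measurable (D j).
  rewrite -[D j]setTI.
  have [mg _] : bounded_meas S' (gap j).
    by apply: bounded_measB => //; exact: bounded_meas_fpiece.
  exact: mg.
pose E (j : 'I_m.+1) : set (Rp R p) := D j `&` 
    \bigcap_(i in [set i : 'I_m.+1 | (i < j)%N]) ~` D i.
have mE j : measurable (E j).
  apply: measurableI => //; apply: fin_bigcap_measurable => // i _.
  exact: measurableC.
have E_triv : trivIset setT E.
  apply/trivIsetP => i j _ _ ij; apply/seteqP; split=> // xi [[Di Hi] [Dj Hj]].
  have [lt_ij|lt_ji|/val_inj eq_ij] := ltngtP i j.
  - exact: Hj Di.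
  - exact: Hi Dj.
  - by rewrite eq_ij eqxx in ij.
have E_cover xi : exists j, E j xi.
  have [j0 lossj0] := loss_attained a b (- returns r x xi - t).
  have Dj0 : D j0 xi.
    by rewrite /D /= /gap /slack /fpiece lossj0 subrr.
  case: (@arg_minnP _ j0 (fun j => gap j xi == 0) (fun j => j : nat)); first exact/eqP.
  move=> j /eqP Dj minj; exists j; split=> // i /= ltij Di.
  by have := minj i (introT eqP Di); rewrite leqNgt ltij.
pose mu j : {finite_measure set (Rp R p) -> \bar R} := mrestr nu (mE j).
have muE (F : set (Rp R p)) : measurable F -> nu F = (\sum_(j < m.+1) mu j F)%E.
  move=> mF; rewrite -[RHS](@measure_semi_additive_ord _ _ _ nu _ (fun j => F `&` E j)).
  - congr (nu _); rewrite -bigcup_mkord_ord; apply/seteqP; split=> [xi Fxi|xi [_ _ []//]].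
    by have [j Ej] := E_cover xi; exists j => //=; rewrite inord_val.
  - by move=> j; apply: measurableI.
  - apply/trivIsetP => i j ? ? ij; move/trivIsetP : E_triv => /(_ i j) H.
    by rewrite setIACA H// setI0.
  - by apply: bigsetU_measurable => j _; apply: measurableI.
have muSE j : mu j (~` (S' `&` E j)) = 0%E.
  apply: (subset_measure0 (mu := nu) _ _ _ nuS).
  - by apply: measurableI => //; apply/measurableC/measurableI.
  - exact: measurableC.
  - by move=> xi [nSE Exi] Sxi; apply: nSE.
have muS j : supported S (mu j).
  apply: (subset_measure0 (mu := mu j) _ _ _ (muSE j)).
  - exact: measurableC.
  - exact/measurableC/measurableI.
  - by move=> xi nS [].
exists mu; split=> //; rewrite (Rintegral_measure_sum S_meas muS muE slackP).
apply: eq_bigr => j _; apply: (eq_on_Rintegral _ (muSE j)).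
- exact: measurableI.
- by case: (bounded_meas_fpiece j t x) => mf [M fM]; split=> //; exists M => xi [/fM].
- by case: slackP => mf [M fM]; split=> //; exists M => xi [/fM].
- by move=> xi [_ [/eqP + _]]; rewrite /D /= subr_eq0 => /eqP.
Qed.

End FixedDecision.
End Reformulation.

(** * Weak duality *)

Lemma qmodule_ge0 (R : realType) (p m1 k : nat) (g : 'I_m1 -> mpoly p R)
    (q : mpoly p R) (xi : 'rV[R]_p) :
  qmodule g k q -> semialg_set g xi -> 0 <= meval (xi 0) q.
Proof.
have sos_ge0 e s : sos e s -> 0 <= meval (xi 0) s.
  move=> [_ [us ->]]; rewrite raddf_sum sumr_ge0// => u _ /=.
  by rewrite expr2 mevalM -expr2 sqr_ge0.
move=> [s0 [s [/sos_ge0 s0_ge0 s_ge0 ->]]] xiS.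
rewrite mevalD addr_ge0// raddf_sum sumr_ge0// => i _ /=.
by rewrite mevalM mulr_ge0//; apply: sos_ge0 (s_ge0 i).
Qed.

Section Duality.
Variables (R : realType) (n p m d : nat).
Variables (r : 'I_n -> mpoly p R) (lambda : R) (a b : 'I_m.+1 -> R).
Variables (A : 'I_m.+1 -> 'M[R]_(nexp p d, n)) (c : 'I_m.+1 -> tms R p d).
Hypothesis fpieceE : forall j t x xi,
  fpiece lambda a b r j t x xi = dot (fcoef a A c j t x) (mono_vec d xi).
Variables (S : set 'rV[R]_p) (B : set (tms R p d)).
Hypothesis S_compact : compact S.
Hypothesis S_meas : measurable (S : set (Rp R p)).

(** Minimizing over the decompositions of a measure turns the sum of the
    integrals of the f_j into lambda minus the expected loss. *)
Lemma dro_feasible_original t x :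
  dro_feasible lambda a b r S B t x <-> original_feasible lambda a b r S B t x.
Proof.
split=> -[x_simplex feas]; split=> //.
  apply: ge_ereal_sup => _ [nu [nuS nuB] ->].
  have [mu [muS nuE muI]] := slack_attained_split fpieceE S_compact S_meas t x nuS.
  rewrite (expectation_loss_le fpieceE S_compact S_meas t x nuS) -muI.
  by apply: feas => //; exists nu.
move=> mu muS [nu nuM nuE].
apply: le_trans (slack_le_split fpieceE S_compact S_meas t x muS nuE).
have [nuS _] := nuM; rewrite -(expectation_loss_le fpieceE S_compact S_meas t x nuS).
by apply: le_trans feas; apply: ereal_sup_ubound; exists nu.
Qed.

Lemma primal_feasible_dro (m1 k : nat) (g : 'I_m1 -> mpoly p R)
    (P : primal_point R n p d) :
  S = semialg_set g -> primal_feasible g B a A c k P ->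
  dro_feasible lambda a b r S B (pp_t P) (pp_x P).
Proof.
move=> SE; case: P => t x w [/= x_simplex [q1 q1_qm [q2 [q2d q2B] wE]] fw]; split=> //.
move=> mu muS [nu [nuS nuB] nuE].
have bw := bounded_meas_dot S_compact w.
apply: (@le_trans _ _ (\sum_(j < m.+1) Rintegral (mu j) setT (fun xi => dot w (mono_vec d xi)))).
  rewrite -(Rintegral_measure_sum S_meas muS nuE bw).
  have b2 := bounded_meas_dot S_compact (vec d q2).
  have q2_ge0 : 0 <= Rintegral nu setT (fun xi => dot (vec d q2) (mono_vec d xi)).
    rewrite (Rintegral_dot S_compact S_meas _ nuS).
    apply: le_trans (q2B _ nuB) _; rewrite le_eqVlt; apply/orP; left; apply/eqP.
    by apply: eq_bigr => i _; rewrite [vec d q2 i 0]mxE.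
  apply: le_trans q2_ge0 _; apply: (le_on_Rintegral S_meas nuS b2 bw) => xi xiS.
  rewrite !dot_mono_vec poly_of_vec// -wE mevalD lerDr.
  by apply: (qmodule_ge0 q1_qm); rewrite -SE.
apply: ler_sum => j _.
apply: (le_on_Rintegral S_meas (muS j) bw).
  exact: (bounded_meas_fpiece fpieceE).
move=> xi xiS; rewrite fpieceE -subr_ge0 -dotBl dot_mono_vec.
by apply: (qmodule_ge0 (fw j)); rewrite -SE.
Qed.

Hypothesis B_conic : given_by_conic_constraints B.

(** The entry at the exponent 0 of a moment vector is the total mass, so dividing
    by it makes a conic combination of moments of probabilities convex. *)
Lemma ambiguity_cone_normalize (y : tms R p d) :
  ambiguity_cone S B y -> 0 < dot (e1 d) y -> B ((dot (e1 d) y)^-1 *: y).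
Proof.
move=> [s [c' [u [cu yE]]]]; set kappa := dot _ y => kappa_gt0.
have u_mass i : dot (e1 d) (u i) = 1.
  have [_ [nu [nuS _] ->]] := cu i.
  by rewrite (dot_e1_moments d S_compact S_meas nuS) (congr1 fine (probability_setT nu)).
have kappaE : kappa = \sum_i c' i.
  by rewrite /kappa yE dot_sumr; apply: eq_bigr => i _; rewrite dotZr u_mass mulr1.
rewrite yE scaler_sumr; under eq_bigr do rewrite scalerA.
apply: conic_constraints_convex => // [i||i].
- by apply: mulr_ge0; [rewrite invr_ge0 ltW|case: (cu i)].
- by rewrite -mulr_sumr -kappaE mulVf// gt_eqF.
- by have [_ [nu [_ nuB] ->]] := cu i.
Qed.

Lemma fcoef_pairing j t x (y : tms R p d) :
  dot (fcoef a A c j t x) y =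
    a j * dot (e1 d) y * t + dot x ((A j)^T *m y) + dot (c j) y.
Proof.
rewrite /fcoef !dotDl dotZl; congr (_ + _ + _); first by rewrite mulrAC.
by rewrite !dotE trmx_mul mulmxA.
Qed.

(** The y_j divided by their total mass kappa have representing measures, whose
    sum nu is a probability; its moment vector belongs to B, so the robust
    constraint applies to this decomposition. *)
Lemma moment_cone_feasible_ge0 (y : 'I_m.+1 -> tms R p d) t x :
  (forall j, moment_cone d S (y j)) -> ambiguity_cone S B (\sum_j y j) ->
  dot (e1 d) (\sum_j y j) != 0 ->
  dro_feasible lambda a b r S B t x ->
  0 <= \sum_j dot (fcoef a A c j t x) (y j).
Proof.
set kappa := dot _ _ => y_cone y_K kappa_neq0 [_ feas].
have mass_ge0 j : 0 <= dot (e1 d) (y j).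
  have [mu muS <-] := moment_cone_measure S_compact S_meas (y_cone j).
  by rewrite (dot_e1_moments d S_compact S_meas muS) fine_ge0.
have kappa_gt0 : 0 < kappa.
  by rewrite lt_neqAle eq_sym kappa_neq0 /kappa dot_sumr sumr_ge0.
have kV_ge0 : 0 <= kappa^-1 by rewrite invr_ge0 ltW.
have mu_ex j : exists mu : {finite_measure set (Rp R p) -> \bar R},
    supported S mu /\ moments d mu = kappa^-1 *: y j.
  have [mu muS muE] := moment_cone_measure S_compact S_meas (coneZ kV_ge0 (y_cone j)).
  by exists mu.
have /choice[mu muP] := mu_ex.
have muS j : supported S (mu j) by case: (muP j).
pose total := measure_sum mu.
have totalS : supported S total.
  by apply: etrans (measure_sumE _ _) _; rewrite big1// => j _; exact: muS.
have total_moments : moments d total = kappa^-1 *: \sum_j y j.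
  apply/colP => i; rewrite mxE.
  have bX : bounded_meas (S : set (Rp R p)) (fun xi => mono_vec d xi i 0).
    under eq_fun do rewrite mxE.
    exact/bounded_meas_continuous/continuous_meval.
  rewrite (Rintegral_measure_sum S_meas muS (nu := total) _ bX); last first.
    by move=> E mE; apply: measure_sumE.
  rewrite scaler_sumr summxE; apply: eq_bigr => j _.
  by rewrite -(muP j).2 [RHS]mxE.
have total1 : total setT = 1%E.
  have := dot_e1_moments d S_compact S_meas totalS.
  rewrite total_moments dotZr mulVf// => total1.
  by rewrite -[LHS]fineK ?fin_num_measure// -total1.
pose nu : probability (Rp R p) R := mnormalize total (dirac (0 : Rp R p)).
have nuE E : nu E = total E.
  have normalize1 (e : \bar R) (P : set (Rp R p) -> \bar R) : e = 1%E ->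
      (if (e == 0)%E || (e == +oo)%E then fun U => P U
       else fun U => (total U * (fine e)^-1%:E)%E) E = total E.
    by move=> ->; rewrite onee_eq0 /= invr1 mule1.
  exact: normalize1 total1.
have nuM : ambiguity S B nu.
  split; first exact: etrans (nuE _) totalS.
  have -> : moments d nu = moments d total.
    apply/colP => i; rewrite !mxE; congr fine; apply: eq_measure_integral => E mE _.
    exact: nuE.
  by rewrite total_moments; apply: ambiguity_cone_normalize.
have := feas mu muS.
have nuE' E : measurable E -> nu E = (\sum_(j < m.+1) mu j E)%E.
  by move=> _; apply: etrans (nuE E) (measure_sumE _ _).
move=> /(_ (ex_intro2 _ _ nu nuM nuE')).
under eq_bigr => j _.
  under eq_fun do rewrite fpieceE.
  rewrite (Rintegral_dot S_compact S_meas _ (muS j)) (muP j).2 dotZr.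
  over.
by rewrite -mulr_sumr pmulr_rge0// invr_gt0.
Qed.

(** Expanding the f_j in the preceding inequality, the constraints of (D_k) leave
    t - gamma_0 - x^T gamma + sum_j c_j^T y_j >= 0, and x^T gamma >= 0.  The
    total mass cannot vanish, since the masses are nonnegative and
    sum_j a_j (e_1^T y_j) = 1. *)
Lemma weak_duality (m1 k : nat) (g : 'I_m1 -> mpoly p R) (D : dual_point R n p m d k) t x :
  dual_feasible g B a A D ->
  (forall j, moment_cone d S (dp_y D j)) ->
  ambiguity_cone S B (\sum_j dp_y D j) ->
  dro_feasible lambda a b r S B t x ->
  dual_value c (dp_gamma0 D) (dp_y D) <= t.
Proof.
case: D => gamma0 gamma y z [/= gamma_ge0 mass1 stationary _ _] y_cone y_K feas.
have y_neq0 : dot (e1 d) (\sum_j y j) != 0.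
  apply/eqP; rewrite dot_sumr => mass0.
  have mass_ge0 j : 0 <= dot (e1 d) (y j).
    have [mu muS <-] := moment_cone_measure S_compact S_meas (y_cone j).
    by rewrite (dot_e1_moments d S_compact S_meas muS) fine_ge0.
  move: mass1; rewrite big1 => [|j _]; first by move/eqP; rewrite eq_sym oner_eq0.
  by rewrite (psumr_eq0P _ mass0) ?mulr0.
have := moment_cone_feasible_ge0 y_cone y_K y_neq0 feas.
under eq_bigr do rewrite fcoef_pairing.
rewrite !big_split /= -mulr_suml mass1 mul1r.
have [[x_ge0 x_sum1] _] := feas.
have -> : \sum_j dot x ((A j)^T *m y j) = - gamma0 - dot x gamma.
  rewrite -dot_sumr.
  have -> : \sum_j (A j)^T *m y j = - (const_mx gamma0 + gamma).
    by apply/eqP; rewrite -addr_eq0 addrC stationary.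
  rewrite -scaleN1r dotZr dotDr mulN1r opprD; congr (- _ - _).
  by rewrite /dot; under eq_bigr do rewrite mxE; rewrite -mulr_suml x_sum1 mul1r.
have : 0 <= dot x gamma by apply: sumr_ge0 => i _; apply: mulr_ge0.
rewrite /dual_value; lra.
Qed.

End Duality.

Theorem theorem4p2 (R : realType) (n p m m1 d : nat)
  (r : 'I_n -> mpoly p R) (lambda : R) (a b : 'I_m.+1 -> R)
  (g : 'I_m1 -> mpoly p R) (B : set (tms R p d))
  (A : 'I_m.+1 -> 'M[R]_(nexp p d, n)) (c : 'I_m.+1 -> tms R p d)
  (rho : mpoly p R)
  (tstar : R) (xstar : 'cV[R]_n) (wstar : tms R p d)
  (gamma0 : R) (gamma : 'cV[R]_n) (ystar : 'I_m.+1 -> tms R p d) :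
  let S := semialg_set g in
  let K := ambiguity_cone S B in
  deg_tuple r = d ->
  0 < lambda ->
  (forall Z Z', Z <= Z' -> loss a b Z <= loss a b Z') ->
  (exists Z Z', loss a b Z <> loss a b Z') ->
  (forall j t x xi,
     fpiece lambda a b r j t x xi = dot (fcoef a A c j t x) (mono_vec d xi)) ->
  given_by_conic_constraints B ->
  K = moment_cone d S `&` cone B ->
  closed (cone B) ->
  dual_cone K = add_sets (nonneg_polys d S) (dual_cone B) ->
  compact S ->
  sos (2 * uphalf d + 2) rho ->
  terminates_with g B a A c rho
    (PrimalPoint tstar xstar wstar) gamma0 gamma ystar ->
  tstar = dual_value c gamma0 ystar ->
  is_minimizer (dro_feasible lambda a b r S B) tstar xstar /\
  (forall t x, dro_feasible lambda a b r S B t x <->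
               original_feasible lambda a b r S B t x).
Proof.
move=> S K _ _ _ _ fpieceE B_conic KE _ _ S_compact _ run tstarE.
have S_meas : measurable (S : set (Rp R p)) := measurable_semialg g.
have [k [D [[P_feas _] [D_feas _] [g0E _ yE] y_flat]]] := terminates_sound run.
split; last by move=> t x; exact: dro_feasible_original.
split; first exact: (primal_feasible_dro fpieceE S_compact S_meas erefl P_feas).
move=> t x feas; rewrite tstarE g0E yE.
have y_cone j : moment_cone d S (dp_y D j).
  rewrite -yE; have [->|/y_flat[l [v [[<- vg] fv]]]] := eqVneq (ystar j) 0.
    exact: cone0.
  exact: flat_extension_moment_cone.
apply: (weak_duality fpieceE S_compact S_meas B_conic D_feas y_cone _ feas).
rewrite -[ambiguity_cone S B]/K KE; split; first exact: cone_sum.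
by have [_ _ _ _ []] := D_feas.
Qed.
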